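(* For every $\epsilon>0$ and every integer $t\ge 3$ there exists $n_0=n_0(\epsilon,t)$ such that every $n$-vertex graph $G$ with $n\ge n_0$ and $d(G)\ge c(t)+\epsilon$ contains a $K_t$-minor of order $O\left(\frac{c(t)t^2}{\epsilon}\log n\,\log\log n\right)$.
   Context: All graphs are finite, without loops or parallel edges. Logarithms are base 2. The constant implicit in the $O(\cdot)$ notation is absolute. The order of a graph is its number of vertices, and $d(G)=|E(G)|/|V(G)|$. A graph $G$ has a $K_t$-minor if it contains $t$ vertex-disjoint connected subgraphs $S_1,\ldots,S_t$ and $\binom t2$ paths $(P_{i,j})_{1\le i<j\le t}$ such that $P_{i,j}$ connects $S_i$ to $S_j$, each $P_{i,j}$ is disjoint from all $S_k$ with $k\ne i,j$, and the paths are internally vertex-disjoint (they can meet only at endpoints). The order of the $K_t$-minor is the number of vertices of the subgraph of $G$ formed by the union of all the $S_i$ and $P_{i,j}$. For an integer $t\ge 3$, $c(t)=\min\{c : d(G)\ge c \text{ implies that } G \text{ has a } K_t\text{-minor}\}$, where the implication is over all graphs $G$ (this minimum is known to exist). *)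

(* Defs.v *)
From mathcomp Require Import all_boot all_order all_algebra.

Set Implicit Arguments.
Unset Strict Implicit.
Unset Printing Implicit Defensive.

Import Order.TTheory GRing.Theory Num.Theory.

Record sgraph := SGraph {
  vertex :> finType;
  adj : rel vertex;
  adj_sym : symmetric adj;
  adj_irrefl : irreflexive adj }.

Definition edges (G : sgraph) : {set {set G}} :=
  [set [set x; y] | x in G, y in G & adj x y].

(* Not necessarily induced. *)
Record subgraph (G : sgraph) := Subgraph {
  sub_verts : {set G};
  sub_adj : rel G;
  sub_adj_sym : symmetric sub_adj;
  sub_adj_sub : forall x y, sub_adj x y ->
    [/\ adj x y, x \in sub_verts & y \in sub_verts] }.

Definition sub_connected (G : sgraph) (H : subgraph G) : Prop :=
  sub_verts H != set0 /\
  {in sub_verts H &, forall x y, connect (sub_adj H) x y}.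

(* The path with vertex sequence path_start :: path_rest. *)
Record gpath (G : sgraph) := GPath {
  path_start : G;
  path_rest : seq G;
  path_adj : path (@adj G) path_start path_rest;
  path_uniq : uniq (path_start :: path_rest) }.

Definition path_end (G : sgraph) (P : gpath G) : G :=
  last (path_start P) (path_rest P).

Definition path_verts (G : sgraph) (P : gpath G) : {set G} :=
  [set x in path_start P :: path_rest P].

Definition path_inner (G : sgraph) (P : gpath G) : {set G} :=
  path_verts P :\: [set path_start P; path_end P].

(* Only the values km_path i j with i < j are meaningful; the other ones are
   unconstrained and ignored, in particular by km_order. *)
Record complete_minor (G : sgraph) (t : nat) := CompleteMinor {
  km_branch : 'I_t -> subgraph G;
  km_path : 'I_t -> 'I_t -> gpath G;
  km_connected : forall i, sub_connected (km_branch i);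
  km_disjoint : forall i j : 'I_t, i != j ->
    [disjoint sub_verts (km_branch i) & sub_verts (km_branch j)];
  km_path_ends : forall i j : 'I_t, i < j ->
    path_start (km_path i j) \in sub_verts (km_branch i) /\
    path_end (km_path i j) \in sub_verts (km_branch j);
  km_path_avoids : forall i j k : 'I_t, i < j -> k != i -> k != j ->
    [disjoint path_verts (km_path i j) & sub_verts (km_branch k)];
  km_path_inner : forall i j k l : 'I_t, i < j -> k < l -> (i, j) != (k, l) ->
    [disjoint path_inner (km_path i j) & path_verts (km_path k l)] }.

Definition km_order (G : sgraph) (t : nat) (M : complete_minor G t) : nat :=
  #|(\bigcup_i sub_verts (km_branch M i))
    :|: (\bigcup_(ij : 'I_t * 'I_t | ij.1 < ij.2)
           path_verts (km_path M ij.1 ij.2))|.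

From mathcomp Require Import classical_sets reals exp.

Local Open Scope ring_scope.

Definition density (R : realType) (G : sgraph) : R :=
  #|edges G|%:R / #|G|%:R.

Definition forcing_densities (R : realType) (t : nat) : set R :=
  [set c : R | forall G : sgraph, c <= density R G ->
                 inhabited (complete_minor G t)]%classic.

(* c = c(t), the least element of forcing_densities t. *)
Definition is_extremal_density (R : realType) (t : nat) (c : R) : Prop :=
  forcing_densities t c /\ lbound (forcing_densities t) c.

Definition log2 (R : realType) (x : R) : R := ln x / ln 2.

(* Main.v *)
Require Import Defs.
From mathcomp Require Import all_boot all_order all_algebra.
From mathcomp Require Import boolp reals sequences exp zify lra.

Set Implicit Arguments.
Unset Strict Implicit.
Unset Printing Implicit Defensive.

Import Order.TTheory GRing.Theory Num.Theory.

(** A minor of order O(log n), with a constant depending on eps and t, is found,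
    which is more than enough for n large.

    Weighing subgraphs by (a + eta ln m) m edges on m vertices, with eta of
    order eps / ln n, a smallest sufficiently dense subgraph H loses little
    density and is a vertex expander: a set S with small neighbourhood satisfies
    |S| (ln m - ln |N[S]|) <= kappa (|N[S]| - |S|), with kappa = O(ln n).  In
    particular sets of size at most m^(1-theta) grow by a constant factor in
    kappa / ln m steps, so balls reach m^(1-theta) vertices within
    radius O(kappa / theta), even when a small set of vertices is forbidden.

    If m is at least a fixed power of kappa, take m^alpha disjoint connected
    clusters of radius O(kappa), and a maximal family of vertex-disjoint paths
    of length O(kappa) between them, at most one for each ordered pair.  Were
    more than about m^theta clusters without a path between any two of them,
    their balls in the complement of the paths would be disjoint and overfill
    H.  Hence the pairs joined by a path form an almost dense digraph, and for
    theta small with respect to alpha / t it contains a biclique with t clusters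
    on each side none of whose paths meets a foreign cluster of the biclique.
    Joining the i-th clusters of both sides gives a K_t-minor.

    If m is polylogarithmic in n, the same step inside H leads to a minor or to
    a subgraph that is denser than c and has fewer than ln n vertices, which
    contains a K_t-minor by the definition of c. *)

(** * Connected sets *)

Lemma meetP (T : finType) (A B : {set T}) :
  reflect (exists2 x, x \in A & x \in B) (~~ [disjoint A & B]).
Proof.
rewrite -setI_eq0; apply: (iffP (set0Pn _)) => [[x]|[x xA xB]].
  by rewrite inE => /andP[xA xB]; exists x.
by exists x; rewrite inE xA.
Qed.

Definition radj (G : sgraph) (S : {set G}) : rel G :=
  [rel x y | [&& adj x y, x \in S & y \in S]].

Definition conn (G : sgraph) (S : {set G}) : Prop :=
  S != set0 /\ {in S &, forall x y, connect (radj S) x y}.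

Lemma radjE (G : sgraph) (S : {set G}) x y :
  radj S x y = [&& adj x y, x \in S & y \in S].
Proof. by []. Qed.

Lemma radj_sym (G : sgraph) (S : {set G}) : symmetric (radj S).
Proof.
by move=> x y; rewrite !radjE adj_sym; case: adj => //=; rewrite andbC.
Qed.

Lemma connect_radjC (G : sgraph) (S : {set G}) x y :
  connect (radj S) x y = connect (radj S) y x.
Proof. exact: (sym_connect_sym (@radj_sym G S)). Qed.

Lemma connect_radjS (G : sgraph) (S T : {set G}) x y :
  S \subset T -> connect (radj S) x y -> connect (radj T) x y.
Proof.
move=> /subsetP sST; apply: connect_sub => u v /and3P[uv uS vS].
by apply: connect1; rewrite radjE uv !sST.
Qed.

Lemma conn1 (G : sgraph) (x : G) : conn [set x].
Proof.
split; first by apply/set0Pn; exists x; rewrite inE.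
by move=> u v; rewrite !inE => /eqP-> /eqP->.
Qed.

Lemma conn_cover (G : sgraph) (A S : {set G}) : conn A -> A \subset S ->
  {in S, forall x, exists2 a, a \in A & connect (radj S) x a} -> conn S.
Proof.
move=> [/set0Pn[a0 a0A] cA] sAS cov; split.
  by apply/set0Pn; exists a0; exact: (subsetP sAS).
move=> x y /cov[a aA xa] /cov[b bA yb]; apply: connect_trans xa _.
rewrite connect_radjC; apply: connect_trans yb _.
by apply: connect_radjS sAS _; exact: cA.
Qed.

Lemma conn_cover_sub (G : sgraph) (A S : {set G}) : conn A -> A \subset S ->
  {in S, forall x, exists P : {set G},
    [/\ conn P, P \subset S, x \in P & ~~ [disjoint P & A]]} -> conn S.
Proof.
move=> cA sAS cov; apply: (conn_cover cA sAS) => x /cov[P [[_ cP] sPS xP]].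
move=> /meetP[a aP aA]; exists a => //.
by apply: connect_radjS sPS _; exact: cP.
Qed.

Lemma connU (G : sgraph) (A B : {set G}) (x y : G) :
  conn A -> conn B -> x \in A -> y \in B -> (x == y) || adj x y ->
  conn (A :|: B).
Proof.
move=> cA [_ cB] xA yB xy; apply: (conn_cover cA (subsetUl _ _)) => z.
rewrite inE => /orP[zA|zB]; first by exists z.
exists x => //; apply: (@connect_trans _ _ y).
  by apply: connect_radjS (subsetUr A B) _; exact: cB.
case/orP: xy => [/eqP->//|xy]; apply: connect1.
by rewrite radjE adj_sym xy !inE xA yB orbT.
Qed.

(* Q is the component of P :\: Y containing a common vertex of P and X. *)
Lemma conn_link (G : sgraph) (P X Y : {set G}) :
  conn P -> ~~ [disjoint P & X] -> ~~ [disjoint P & Y] -> [disjoint X & Y] ->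
  exists Q : {set G}, [/\ conn Q, Q \subset P, ~~ [disjoint Q & X],
    [disjoint Q & Y] & exists u e, [/\ u \in Q, e \in Y & adj u e]].
Proof.
move=> [_ cP] /meetP[x xP xX] /meetP[y yP yY] dXY.
have xY : x \notin Y by rewrite (disjointFr dXY xX).
pose D := P :\: Y; pose Q := [set z | connect (radj D) x z].
have xQ : x \in Q by rewrite inE.
have xD : x \in D by rewrite inE xY.
have sQD : Q \subset D.
  apply/subsetP => z; rewrite inE => /connectP[p].
  elim: p x {xX xP xY Q xQ cP} xD => [|w p IH] x xD /=; first by move=> _ ->.
  by move=> /andP[/and3P[_ _ wD] pw] zl; exact: (IH w wD pw zl).
have stepQ w v : w \in Q -> v \in D -> adj w v -> v \in Q.
  move=> wQ vD wv; rewrite inE; apply: (@connect_trans _ _ w).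
    by rewrite inE in wQ.
  by apply: connect1; rewrite radjE wv vD (subsetP sQD).
(* Connectivity is needed inside [Q], not just inside [D]: a walk of [radj D] from a vertex of [Q]
   never leaves [Q]. *)
have sQ p : forall w, w \in Q -> path (radj D) w p ->
    connect (radj Q) w (last w p).
  elim: p => [|v p IH] w wQ //= /andP[/and3P[wv _ vD] pv].
  have vQ : v \in Q by exact: stepQ wQ vD wv.
  by apply: connect_trans (connect1 _) (IH v vQ pv); rewrite radjE wv wQ.
have {}sQ : {in Q, forall z, connect (radj Q) x z}.
  by move=> z; rewrite inE => /connectP[p pp ->]; exact: sQ.
exists Q; split.
- split; first by apply/set0Pn; exists x.
  by move=> u v uQ vQ; apply: (@connect_trans _ _ x); rewrite ?sQ //
    connect_radjC sQ.
- by apply: subset_trans sQD (subsetDl _ _).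
- by apply/meetP; exists x.
- by rewrite -setI_eq0; apply/eqP/setP => z; rewrite !inE; apply/negbTE/negP
    => /andP[zQ zY]; have := subsetP sQD z; rewrite !inE zQ zY => /(_ isT).
(* Walk from [x] to [y] inside [P]: before its first vertex in [Y] the walk stays in [Q], so that
   vertex and its predecessor serve as [e] and [u]. *)
have /connectP[p] := cP _ _ xP yP.
have: x \in Q by []; elim: p {xQ} (x) => [|w p IH] z zQ /=.
  by move=> _ yz; have := subsetP sQD z zQ; rewrite -yz inE yY.
move=> /andP[/and3P[zw zP wP] pw] yw; have [wY|wY] := boolP (w \in Y).
  by exists z, w.
by apply: (IH w _ pw yw); apply: stepQ zQ _ zw; rewrite inE wY.
Qed.

(** * Minors from branch sets, and minors of induced subgraphs *)

Lemma radj_sub (G : sgraph) (S : {set G}) x y :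
  radj S x y -> [/\ adj x y, x \in S & y \in S].
Proof. by move=> /and3P. Qed.

Definition induced_sub (G : sgraph) (S : {set G}) : subgraph G :=
  Subgraph (@radj_sym G S) (@radj_sub G S).

Lemma edge_path (G : sgraph) (x y : G) : adj x y -> exists P : gpath G,
  [/\ path_start P = x, path_end P = y & path_verts P = [set x; y]].
Proof.
move=> xy.
have pth : path (@adj G) x [:: y] by rewrite /= xy.
have unq : uniq [:: x; y].
  by rewrite /= inE andbT; apply: contraTneq xy => ->; rewrite adj_irrefl.
exists (GPath pth unq); split=> //.
by apply/setP => z; rewrite !inE.
Qed.

(** Each connecting path is a single edge, so path interiors are empty and every vertex of the minor
    lies in a branch set. *)
Lemma minor_of_branches (G : sgraph) t (B : 'I_t -> {set G}) :
  (forall i, conn (B i)) ->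
  (forall i j, i != j -> [disjoint B i & B j]) ->
  (forall i j : 'I_t, i < j ->
     exists x y, [/\ x \in B i, y \in B j & adj x y]) ->
  exists M : complete_minor G t, km_order M <= #|\bigcup_i B i|.
Proof.
move=> cB dB eB.
have [P PE] : exists P : 'I_t * 'I_t -> gpath G,
    forall ij : 'I_t * 'I_t, ij.1 < ij.2 ->
    [/\ path_start (P ij) \in B ij.1, path_end (P ij) \in B ij.2 &
      path_verts (P ij) = [set path_start (P ij); path_end (P ij)]].
  apply: (fin_all_exists (U := fun=> gpath G)
    (P := fun (ij : 'I_t * 'I_t) Q => ij.1 < ij.2 ->
      [/\ path_start Q \in B ij.1, path_end Q \in B ij.2 &
        path_verts Q = [set path_start Q; path_end Q]])) => -[i j] /=.
  have [/eB[x [y [xi yj xy]]]|ij] := ltnP i j.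
    by have [Q [Q1 Q2 Q3]] := edge_path xy; exists Q; rewrite Q1 Q2.
  (* Default for the pairs with [j <= i], whose paths are ignored. *)
  have /set0Pn[x _] := (cB i).1.
  by exists (@GPath G x [::] isT isT).
have PB (i j : 'I_t) : i < j -> path_verts (P (i, j)) \subset B i :|: B j.
  move=> ij; have [s e ->] := PE (i, j) ij.
  by rewrite subUset !sub1set !inE s e orbT.
have disj (i j k : 'I_t) : i < j -> k != i -> k != j ->
    [disjoint path_verts (P (i, j)) & B k].
  move=> ij ki kj; apply: disjointWl (PB _ _ ij) _.
  by rewrite -setI_eq0 setIUl setU_eq0 !setI_eq0 !dB // eq_sym.
have inner (i j k l : 'I_t) : i < j -> k < l -> (i, j) != (k, l) ->
    [disjoint path_inner (P (i, j)) & path_verts (P (k, l))].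
  move=> ij _ _; rewrite /path_inner; have [_ _ {1}->] := PE (i, j) ij.
  by rewrite setDv -setI_eq0 set0I.
pose M := @CompleteMinor G t (fun i => induced_sub (B i)) (fun i j => P (i, j))
  cB dB (fun i j ij => let: And3 s e _ := PE (i, j) ij in conj s e) disj inner.
exists M; apply: subset_leq_card; rewrite /= subUset subxx /=.
apply/bigcupsP => -[i j] /= ij; apply: subset_trans (PB _ _ ij) _.
by rewrite subUset !(bigcup_sup _) .
Qed.

Lemma induced_adj_sym (G : sgraph) (A : {set G}) :
  symmetric (fun x y : {x | x \in A} => adj (val x) (val y)).
Proof. by move=> x y; rewrite adj_sym. Qed.

Lemma induced_adj_irrefl (G : sgraph) (A : {set G}) :
  irreflexive (fun x y : {x | x \in A} => adj (val x) (val y)).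
Proof. by move=> x; rewrite adj_irrefl. Qed.

Definition induced (G : sgraph) (A : {set G}) : sgraph :=
  SGraph (@induced_adj_sym G A) (@induced_adj_irrefl G A).

Lemma card_induced (G : sgraph) (A : {set G}) : #|induced A| = #|A|.
Proof. by rewrite card_sig. Qed.

Section Transfer.
Variables (G : sgraph) (A : {set G}).
Local Notation H := (induced A).
Let f (x : H) : G := val x.
Let f_inj : injective f. Proof. exact: val_inj. Qed.

Definition push_adj (K : subgraph H) : rel G :=
  [rel x y | [exists u, exists v, [&& f u == x, f v == y & sub_adj K u v]]].

Lemma push_adj_sym K : symmetric (push_adj K).
Proof.
move=> x y; apply/idP/idP => /existsP[u /existsP[v /and3P[ux vy uv]]];
by apply/existsP; exists v; apply/existsP; exists u; rewrite ux vy sub_adj_sym.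
Qed.

Lemma push_adj_sub K x y : push_adj K x y ->
  [/\ adj x y, x \in f @: sub_verts K & y \in f @: sub_verts K].
Proof.
move=> /existsP[u /existsP[v /and3P[/eqP<- /eqP<- /sub_adj_sub[uv uK vK]]]].
by split=> //; apply: imset_f.
Qed.

Definition push_sub (K : subgraph H) : subgraph G :=
  Subgraph (@push_adj_sym K) (@push_adj_sub K).

Lemma push_connected K : sub_connected K -> sub_connected (push_sub K).
Proof.
move=> [K0 cK]; split; first by rewrite /= imset_eq0.
move=> _ _ /imsetP[u uK ->] /imsetP[v vK ->] /=.
have /connectP[p pp ->] := cK u v uK vK; apply/connectP.
exists (map f p); last by rewrite last_map.
elim: p u pp {uK} => //= w p IH u /andP[uw /IH->]; rewrite andbT.
by apply/existsP; exists u; apply/existsP; exists w; rewrite !eqxx.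
Qed.

Lemma push_path_adj (P : gpath H) :
  path (@adj G) (f (path_start P)) (map f (path_rest P)).
Proof. by rewrite path_map; exact: path_adj. Qed.

Lemma push_path_uniq (P : gpath H) :
  uniq (f (path_start P) :: map f (path_rest P)).
Proof. by rewrite -map_cons map_inj_uniq //; exact: path_uniq. Qed.

Definition push_path (P : gpath H) : gpath G :=
  GPath (push_path_adj P) (push_path_uniq P).

Lemma push_path_verts P : path_verts (push_path P) = f @: path_verts P.
Proof.
apply/setP => x; rewrite inE /= -map_cons.
apply/mapP/imsetP => -[u uP ->]; exists u => //; first by rewrite inE.
by rewrite inE in uP.
Qed.

Lemma push_path_inner P : path_inner (push_path P) = f @: path_inner P.
Proof.
rewrite /path_inner push_path_verts /path_end /= last_map.
rewrite -[[set f _; _]]/(f _ |: [set f _]) -!imset_set1 -imsetU.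
apply/setP => x; rewrite inE; apply/andP/imsetP.
  move=> [/negP nx /imsetP[u uP xE]]; exists u => //.
  by rewrite inE uP andbT; apply/negP => ux; apply: nx; rewrite xE imset_f.
move=> [u]; rewrite inE => /andP[nu uP] ->; split; last exact: imset_f.
by rewrite (mem_imset _ _ f_inj).
Qed.

Lemma push_disjoint (X Y : {set H}) :
  [disjoint X & Y] -> [disjoint f @: X & f @: Y].
Proof.
move=> d; apply/negPn/negP => /meetP[_ /imsetP[u uX ->] /imsetP[v vY]].
by move/f_inj => uv; move: (disjointFr d uX); rewrite uv vY.
Qed.

(** The inclusion of [A] is injective, so taking images keeps disjointness, simplicity of paths and
    all cardinalities. *)
Lemma push_minor t (M : complete_minor H t) :
  exists M' : complete_minor G t, km_order M' = km_order M.
Proof.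
have ends (i j : 'I_t) : i < j ->
    path_start (push_path (km_path M i j)) \in
      sub_verts (push_sub (km_branch M i)) /\
    path_end (push_path (km_path M i j)) \in
      sub_verts (push_sub (km_branch M j)).
  move=> ij; have [s e] := km_path_ends M ij.
  by rewrite /path_end /= last_map !imset_f.
have avoid (i j k : 'I_t) : i < j -> k != i -> k != j ->
    [disjoint path_verts (push_path (km_path M i j)) &
      sub_verts (push_sub (km_branch M k))].
  move=> ij ki kj; rewrite push_path_verts; apply: push_disjoint.
  exact: km_path_avoids.
have inner (i j k l : 'I_t) : i < j -> k < l -> (i, j) != (k, l) ->
    [disjoint path_inner (push_path (km_path M i j)) &
      path_verts (push_path (km_path M k l))].
  move=> ij kl ne; rewrite push_path_verts push_path_inner.
  by apply: push_disjoint; exact: km_path_inner.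
exists (@CompleteMinor G t (fun i => push_sub (km_branch M i))
  (fun i j => push_path (km_path M i j))
  (fun i => push_connected (km_connected M i))
  (fun i j ne => push_disjoint (km_disjoint M ne)) ends avoid inner).
rewrite /km_order /= -(card_imset _ f_inj) imsetU !(big_morph _ (imsetU f)
  (imset0 f)).
by congr (#|_ :|: _|); apply: eq_bigr => i _; rewrite push_path_verts.
Qed.

End Transfer.

(** * Bicliques without conflicts *)

Lemma double_count (T T' : finType) (D : T -> T' -> bool) (A : {set T})
    (B : {set T'}) :
  \sum_(x in A) #|[set y in B | D x y]| = \sum_(y in B) #|[set x in A | D x y]|.
Proof.
have cardE (I : finType) (S : {set I}) (p : pred I) :
    #|[set y in S | p y]| = \sum_(y in S) p y.
  rewrite -sum1_card big_mkcond [RHS]big_mkcond /=.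
  by apply: eq_bigr => y _; rewrite inE; case: (y \in S); case: (p y).
under eq_bigr => x _ do rewrite cardE.
by rewrite exchange_big; apply: eq_bigr => y _; rewrite cardE.
Qed.

(** Count incidences: a point of [D] lies in at most one of the sets [F i]. *)
Lemma disjoint_family_card (I T : finType) (S : {set I}) (F : I -> {set T})
    (D : {set T}) n :
  {in S &, forall i j, i != j -> [disjoint F i & F j]} ->
  {in S, forall i, n <= #|F i :&: D|} -> #|S| * n <= #|D|.
Proof.
move=> dF Fn; rewrite -sum_nat_const.
apply: (@leq_trans (\sum_(i in S) #|[set v in D | v \in F i]|)).
  apply: leq_sum => i /Fn/leq_trans-> //; apply: subset_leq_card.
  by apply/subsetP => v; rewrite !inE andbC.
rewrite (double_count (fun i v => v \in F i)) -sum1_card; apply: leq_sum => v _.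
rewrite leqNgt; apply/negP => /card_gt1P[i [j []]].
rewrite !inE => /andP[iS vi] /andP[jS vj] ij.
by have := disjointFr (dF i j iS jS ij) vi; rewrite vj.
Qed.

(** Greedy choice in a digraph with in-degrees at most [d]: by averaging some vertex also has
    out-degree at most [d], and choosing it discards at most [2 d + 1] vertices, itself included. *)
Lemma independent_subset (T : finType) (D : rel T) d (S : {set T}) :
  {in S, forall x, #|[set y in S | D y x]| <= d} ->
  exists I : {set T}, [/\ I \subset S,
    {in I &, forall x y, x != y -> ~~ D x y} & #|S| <= d.*2.+1 * #|I|].
Proof.
have [n] := ubnP #|S|; elim: n S => // n IH S; rewrite ltnS => Sn degS.
have [->|S0] := eqVneq S set0.
  by exists set0; rewrite sub0set cards0; split=> // x y; rewrite inE.
have [x xS xout] : exists2 x, x \in S & #|[set y in S | D x y]| <= d.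
  apply/exists_inP; apply: contraT => /exists_inPn ex.
  have : \sum_(x in S) d.+1 <= \sum_(x in S) d.
    rewrite (@leq_trans (\sum_(x in S) #|[set y in S | D x y]|)) //.
      by apply: leq_sum => x /ex; rewrite -ltnNge.
    by rewrite double_count; apply: leq_sum => x /degS.
  by rewrite !sum_nat_const leq_pmul2l ?ltnn // card_gt0.
pose C := x |: ([set y in S | D x y] :|: [set y in S | D y x]).
have xC : x \in C by rewrite !inE eqxx.
have CS : #|C| <= d.*2.+1.
  rewrite cardsU1 (leq_trans (leq_add (leq_b1 _) (leq_card_setU _ _))) //.
  by rewrite add1n ltnS -addnn leq_add // degS.
have RS : #|S :\: C| < #|S|.
  by apply: proper_card; apply/properP; split; [exact: subsetDl | exists x =>
    //;
    rewrite !inE eqxx].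
have [|y|I [sI iI cI]] := IH (S :\: C); first exact: leq_trans RS Sn.
  rewrite inE => /andP[_ yS]; apply: leq_trans (degS _ yS); apply:
    subset_leq_card.
  by apply/subsetP => z; rewrite !inE => /andP[/andP[_ ->]].
have IC y : y \in I -> y \notin C by move/(subsetP sI); rewrite inE => /andP[].
have IS y : y \in I -> y \in S by move/(subsetP sI); rewrite inE => /andP[].
exists (x |: I); split.
- by rewrite subUset sub1set xS; apply: subset_trans sI (subsetDl _ _).
- move=> y z; rewrite !inE => /orP[/eqP->|yI] /orP[/eqP->|zI]; rewrite ?eqxx //.
  + by move=> _; have := IC _ zI; rewrite !inE IS // !negb_or => /and3P[].
  + by move=> _; have := IC _ yI; rewrite !inE IS // !negb_or => /and3P[].
  + exact: iI.
rewrite cardsU1; have -> /= : x \notin I by apply: contraL xC => /IC.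
rewrite mulnDr muln1 -(cardsID C S) leq_add //.
by apply: leq_trans CS; apply: subset_leq_card; exact: subsetIr.
Qed.

Lemma common_neighbours (T : finType) (A : rel T) (C J : {set T}) d k t :
  0 < d -> J != set0 ->
  {in J, forall y, d + t <= #|[set x in C | A x y]|} -> k <= t ->
  exists (s : seq T) (J' : {set T}),
    [/\ size s = k, uniq s, {subset s <= C}, J' \subset J &
      {in s & J', forall x y, A x y} /\ #|J| * d ^ k <= #|J'| * #|C| ^ k].
Proof.
move=> d0 J0 degJ; elim: k => [|k IH] kt.
  by exists [::], J; rewrite !expn0.
have [s [J' [sk us sC sJ [As cJ]]]] := IH (ltnW kt).
pose C' := C :\: [set x in s].
have degJ' : #|J'| * d <= \sum_(x in C') #|[set y in J' | A x y]|.
  rewrite double_count -sum_nat_const; apply: leq_sum => y yJ'.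
  have := degJ _ (subsetP sJ _ yJ'); rewrite -(cardsID [set x in s]) => degy.
  rewrite -(leq_add2r t) (leq_trans degy) // addnC leq_add //.
    apply: subset_leq_card; apply/subsetP => z; rewrite !inE.
    by case/and3P=> -> -> ->.
  apply: leq_trans (subset_leq_card (subsetIr _ _)) _.
  by rewrite cardsE (leq_trans (card_size _)) // sk ltnW.
have J'0 : 0 < #|J'|.
  have : 0 < #|J'| * #|C| ^ k.
    by apply: leq_trans cJ; rewrite muln_gt0 card_gt0 J0 expn_gt0 d0.
  by rewrite muln_gt0 => /andP[].
have [x xC' xdeg] : exists2 x, x \in C' &
    #|J'| * d <= #|C| * #|[set y in J' | A x y]|.
  apply/exists_inP; apply: contraT => /exists_inPn ex.
  have : \sum_(x in C') (#|C| * #|[set y in J' | A x y]| + 1) <=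
      \sum_(x in C') #|J'| * d.
    by apply: leq_sum => x /ex; rewrite -ltnNge addn1.
  rewrite big_split -big_distrr /= !sum_nat_const muln1.
  have sCC : #|C'| <= #|C| by apply: subset_leq_card; exact: subsetDl.
  have C'0 : 0 < #|C'|.
    rewrite lt0n; apply: contraTneq degJ' => /cards0_eq ->.
    by rewrite big_set0 -ltnNge muln_gt0 J'0.
  move: (leq_mul (leqnn #|C|) degJ') (leq_mul sCC (leqnn (#|J'| * d))); lia.
exists (x :: s), [set y in J' | A x y]; split.
- by rewrite /= sk.
- by rewrite /= us andbT; move: xC'; rewrite !inE => /andP[].
- move=> z; rewrite inE => /orP[/eqP->|/sC//].
  by move: xC'; rewrite inE => /andP[].
- by apply: subset_trans sJ; apply/subsetP => z; rewrite inE => /andP[].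
split.
  move=> z y; rewrite !inE => /orP[/eqP->|zs] /andP[yJ' xy] //.
  exact: As.
rewrite !expnSr !mulnA (leq_trans (leq_mul cJ (leqnn d))) //.
by rewrite mulnAC [leqRHS]mulnAC leq_mul2r [_ * #|C|]mulnC xdeg orbT.
Qed.

(** Since more than [Q] vertices always span an arc, at least half of [C] has large in-degree.
    Conflicts among sources are removed first, inside each in-neighbourhood; conflicts among targets
    are removed last, once the sources are fixed. *)
Lemma conflict_free_biclique (T : finType) (A : rel T)
    (conf : T -> T -> {set T})
    (C : {set T}) Q l t (h := 26 * Q * l) (d := t ^ 2 * l * h ^ t) :
  0 < Q -> 0 < l -> 0 < t -> #|C| = h * d ->
  (forall x y, #|conf x y| <= l) ->
  (forall S : {set T}, S \subset C -> Q < #|S| ->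
     exists x y, [/\ x \in S, y \in S, x != y & A x y]) ->
  exists sx sy : seq T, [/\ size sx = t, size sy = t, uniq sx, uniq sy &
    [/\ {subset sx <= C}, {subset sy <= C}, {in sx & sy, forall x y, A x y},
      {in sx & sx & sy, forall x x' y, x != x' -> x' \notin conf x y} &
      {in sx & sy & sy, forall x y y', y != y' -> y' \notin conf x y}]].
Proof.
move=> Q0 l0 t0 CN confl hole.
have h0 : 0 < h by rewrite !muln_gt0 Q0 l0.
have d0 : 0 < d by rewrite !muln_gt0 !expn_gt0 t0 l0 h0.
have td : t <= d.
  rewrite /d -mulnA expnSr expn1 -mulnA leq_pmulr //.
  by rewrite !muln_gt0 t0 l0 expn_gt0 h0.
pose N y := [set x in C | A x y].
(* The factor [2 l + 1] is lost in making an in-neighbourhood free of conflicts; the remaining [2 d]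
   is at least the [d + t] that [common_neighbours] requires. *)
pose J0 := [set y in C | l.*2.+1 * d.*2 <= #|N y|].
have J0d : 13 * Q * l * d <= #|J0|.
  (* Outside [J0] in-degrees are small, and an independent set there has at most [Q] elements. Hence
     [C :\: J0] has at most [8 Q l d + 4 Q d + Q <= 13 Q l d] elements, half of [|C|]; this is the
     origin of 26. *)
  have [|I [sI iI cI]] := @independent_subset T A (l.*2.+1 * d.*2) (C :\: J0).
    move=> y; rewrite !inE negb_and -ltnNge => /andP[/orP[/negP//|ydeg] yC].
    apply: leq_trans (ltnW ydeg); apply: subset_leq_card.
    by apply/subsetP => x; rewrite !inE => /andP[/andP[_ ->]].
  have IQ : #|I| <= Q.
    rewrite leqNgt; apply/negP => /hole[].
      by apply: subset_trans sI (subsetDl _ _).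
    by move=> x [y [xI yI xy]]; apply/negP; exact: iI.
  have := cardsID J0 C; rewrite CN.
  have /setIidPr-> : J0 \subset C by apply/subsetP => y; rewrite inE => /andP[].
  have := leq_mul (leqnn (l.*2.+1 * d.*2).*2.+1) IQ.
  have : Q * d <= Q * l * d by rewrite leq_mul2r leq_pmulr ?orbT.
  have : Q <= Q * l * d by rewrite -mulnA leq_pmulr // muln_gt0 l0.
  move: cI; rewrite /h.
  have -> : (l.*2.+1 * d.*2).*2.+1 * Q = 8 * (Q * l * d) + 4 * (Q * d) + Q by
    lia.
  have -> : 26 * Q * l * d = 26 * (Q * l * d) by lia.
  have -> : 13 * Q * l * d = 13 * (Q * l * d) by lia.
  lia.
(* F y is a set of in-neighbours of y that is free of conflicts. *)
have [F FE] : exists F : T -> {set T}, forall y, [/\ F y \subset N y,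
    {in F y &, forall x x', x != x' -> x \notin conf x' y} &
    #|N y| <= l.*2.+1 * #|F y|].
  apply: (fin_all_exists (U := fun=> {set T}) (P := fun y (F : {set T}) =>
    [/\ F \subset N y,
    {in F &, forall x x', x != x' -> x \notin conf x' y} &
    #|N y| <= l.*2.+1 * #|F|])) => y.
  apply: (@independent_subset T (fun x x' => x \in conf x' y)) => x _.
  apply: leq_trans (confl x y); apply: subset_leq_card.
  by apply/subsetP => x'; rewrite inE => /andP[].
have [|y|//|sx [J' [sxt usx sxC sJ [AF cJ]]]] :=
  @common_neighbours T (fun x y => x \in F y) C J0 d t t d0.
- by rewrite -card_gt0 (leq_trans _ J0d) // !(muln_gt0, expn_gt0) Q0 l0 t0.
- rewrite [y \in _]inE => /andP[_ yN]; have [sF _ /(leq_trans yN)] := FE y.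
  rewrite leq_pmul2l // => dF; apply: leq_trans (leq_add (leqnn d) td) _.
  rewrite addnn (leq_trans dF) // subset_leq_card //; apply/subsetP => x xF.
  by rewrite inE xF andbT; have := subsetP sF x xF; rewrite inE => /andP[].
have {}cJ : #|J0| <= #|J'| * h ^ t.
  by move: cJ; rewrite CN expnMn mulnA leq_pmul2r // expn_gt0 d0.
(* [D y y'] says that [y] conflicts with a pair formed by a chosen source and [y']; its in-degrees
   are at most [t * l]. *)
pose D y y' := has (fun x => y \in conf x y') sx.
have [y _|I [sI iI cI]] := @independent_subset T D (t * l) J'.
  apply: (@leq_trans #|\bigcup_(x <- sx) conf x y|).
    apply: subset_leq_card; apply/subsetP => z; rewrite inE => /andP[_ /hasP[x
      xs zx]].
    by rewrite bigcup_seq; apply/bigcupP; exists x.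
  rewrite -sxt; elim: (sx) => [|x s IH]; first by rewrite big_nil cards0.
  rewrite big_cons mulSn (leq_trans (leq_card_setU _ _)) //.
  by rewrite leq_add.
(* Otherwise [13 Q l d <= (2 t l + 1) t h ^ t <= 3 t ^ 2 l h ^ t = 3 d], which is impossible; [d] is
   chosen for this. *)
have It : t <= #|I|.
  rewrite leqNgt; apply/negP => ltIt.
  have : 13 * Q * l * d <= (t * l).*2.+1 * t * h ^ t.
    apply: leq_trans J0d _; apply: leq_trans cJ _; rewrite leq_mul2r; apply/orP;
      right.
    by apply: leq_trans cI _; rewrite leq_mul2l ltnW // orbT.
  have : (t * l).*2.+1 * t * h ^ t <= 3 * d.
    rewrite /d !mulnA leq_mul2r; apply/orP; right.
    have : t <= t * l * t by rewrite -mulnA leq_pmulr // muln_gt0 l0.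
    by lia.
  have : d <= Q * l * d by rewrite leq_pmull // muln_gt0 Q0.
  lia.
exists sx, (take t (enum I)).
have syI y : y \in take t (enum I) -> y \in I.
  by move/mem_take; rewrite mem_enum.
have syJ y : y \in take t (enum I) -> y \in J' by move/syI/(subsetP sI).
split=> //; first by rewrite size_takel // -cardE.
  by rewrite take_uniq // enum_uniq.
split=> //.
- move=> y /syJ/(subsetP sJ); by rewrite inE => /andP[].
- move=> x y xs /syJ yJ; have [/subsetP/(_ x) + _ _] := FE y.
  by move/(_ (AF _ _ xs yJ)); rewrite inE => /andP[].
- move=> x x' y xs xs' /syJ yJ xx'; have [_ iF _] := FE y.
  by apply: iF; rewrite ?AF // eq_sym.
- move=> x y y' xs /syI yI /syI y'I yy'.
  have := iI y' y y'I yI; rewrite eq_sym => /(_ yy'); apply: contra => c.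
  by apply/hasP; exists x.
Qed.

(** * Growth of balls *)

Definition nbh (G : sgraph) (S : {set G}) : {set G} :=
  S :|: [set y | [exists x in S, adj x y]].

(** Vertex expansion by a factor [1 + 1/b] up to scale [Z], in integer form. *)
Definition expanding (G : sgraph) (b Z : nat) : Prop := forall S : {set G},
  #|nbh S| <= Z -> #|S| <= b * (#|nbh S| - #|S|).

Definition grow (G : sgraph) (U S : {set G}) : {set G} := nbh S :\: U.

(** A set of radius at most [k] about [z]; the connected sets [P] replace paths from the centre. *)
Definition cluster (G : sgraph) (z : G) (k : nat) (X : {set G}) : Prop :=
  z \in X /\ {in X, forall v, exists P : {set G},
    [/\ P \subset X, conn P, z \in P, v \in P & #|P| <= k.+1]}.

Lemma nbhP (G : sgraph) (S : {set G}) y :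
  reflect (exists2 x, x \in S & (x == y) || adj x y) (y \in nbh S).
Proof.
rewrite !inE; apply: (iffP orP) => [[yS|/exists_inP[x xS xy]]|[x xS]].
- by exists y; rewrite ?eqxx.
- by exists x; rewrite ?xy ?orbT.
- case/orP=> [/eqP<-|xy]; first by left.
  by right; apply/exists_inP; exists x.
Qed.

Lemma sub_nbh (G : sgraph) (S : {set G}) : S \subset nbh S.
Proof. exact: subsetUl. Qed.

Lemma nbhU (G : sgraph) (A B : {set G}) : nbh (A :|: B) = nbh A :|: nbh B.
Proof.
apply/setP => y; rewrite in_setU; apply/nbhP/orP.
  by move=> [x]; rewrite inE => /orP[xA|xB] xy; [left|right]; apply/nbhP; exists
    x.
by move=> [/nbhP[x xS xy]|/nbhP[x xS xy]]; exists x; rewrite // inE xS ?orbT.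
Qed.

Lemma nbh0 (G : sgraph) : nbh (set0 : {set G}) = set0.
Proof.
by apply/setP => y; rewrite [RHS]inE; apply/nbhP => -[x]; rewrite inE.
Qed.

Lemma grow_disjoint (G : sgraph) (U S : {set G}) : [disjoint grow U S & U].
Proof. by rewrite -setI_eq0 setIDAC setDIl setDv setI0. Qed.

Lemma iter_grow_disjoint (G : sgraph) (U S : {set G}) k :
  [disjoint S & U] -> [disjoint iter k (grow U) S & U].
Proof. by case: k => //= k _; exact: grow_disjoint. Qed.

Lemma sub_grow (G : sgraph) (U S : {set G}) :
  [disjoint S & U] -> S \subset grow U S.
Proof. by move=> d; rewrite subsetD d sub_nbh. Qed.

Lemma iter_grow_sub (G : sgraph) (U S : {set G}) k l : [disjoint S & U] ->
  k <= l -> iter k (grow U) S \subset iter l (grow U) S.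
Proof.
move=> d /subnK<-; elim: (l - k) => //= i IH; apply: subset_trans IH _.
by apply: sub_grow; exact: iter_grow_disjoint.
Qed.

(** Bernoulli's inequality for the growth factor [1 + 1/(2b)], cleared of denominators. *)
Lemma growth_step b n (s : nat -> nat) : 0 < b ->
  (forall k, k < n -> b.*2.+1 * s k <= b.*2 * s k.+1) ->
  (b.*2 + n) * s 0 <= b.*2 * s n.
Proof.
move=> b0; elim: n => [|n IH] sk; first by rewrite addn0.
have {}IH := IH (fun k kn => sk k (ltnW kn)).
have s0n : s 0 <= s n.
  rewrite -(leq_pmul2l (_ : 0 < b.*2)) ?double_gt0 //; apply: leq_trans IH.
  by rewrite leq_mul2r leq_addr orbT.
by move: (sk n (ltnSn n)); rewrite mulnDl mulSn mulnDl mulSn in IH *; lia.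
Qed.

(** By [growth_step], each block of [2 b] steps doubles the sequence. *)
Lemma growth_seq b j (s : nat -> nat) : 0 < b ->
  (forall k, k < b.*2 * j -> b.*2.+1 * s k <= b.*2 * s k.+1) ->
  2 ^ j * s 0 <= s (b.*2 * j).
Proof.
move=> b0; elim: j => [|j IH] sk; first by rewrite mul1n muln0.
have {IH} IH := IH (fun k kj => sk k (leq_trans kj (leq_mul (leqnn _) (leqnSn
  j)))).
have := @growth_step b b.*2 (fun i => s (b.*2 * j + i)) b0.
rewrite addn0 -mulnSr => /(_ _)/wrap[k kb|].
  by rewrite addnS; apply: sk; rewrite mulnSr ltn_add2l.
rewrite addnn -mul2n [2 * _]mulnC -mulnA leq_pmul2l ?double_gt0 //.
by apply: leq_trans; rewrite expnS -mulnA leq_mul2l IH orbT.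
Qed.

(** As [|U| <= |X| / (2b)], deleting [U] costs at most half of the expansion, so each step still
    gains a factor [1 + 1/(2b)]; below scale [Z] this would end with more than [|G|] vertices. *)
Lemma grow_large (G : sgraph) b Z j (U X : {set G}) :
  expanding G b Z -> 0 < b -> #|G| < 2 ^ j -> [disjoint X & U] -> X != set0 ->
  b.*2 * #|U| <= #|X| -> Z <= #|iter (b.*2 * j) (grow U) X| + #|U|.
Proof.
move=> expG b0 Gj dXU X0 UX; rewrite leqNgt; apply/negP => small.
pose s k := #|iter k (grow U) X|.
have : 2 ^ j * s 0 <= s (b.*2 * j).
  apply: growth_seq => // k kj; rewrite /s /=.
  set B := iter k _ _; have XB : #|X| <= #|B|.
    by apply: subset_leq_card; exact: (@iter_grow_sub _ _ _ 0).
  have nB : #|nbh B| <= #|grow U B| + #|U|.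
    rewrite -(cardsID U (nbh B)) addnC leq_add2l.
    by apply: subset_leq_card; exact: subsetIr.
  have sB : #|grow U B| <= #|iter (b.*2 * j) (grow U) X|.
    by apply: subset_leq_card; exact: (@iter_grow_sub _ _ _ k.+1).
  have := expG B; move: (subset_leq_card (sub_nbh B)) => BnB.
  rewrite (leq_trans nB) ?(leq_trans (leq_add sB (leqnn _)) (ltnW small)) //.
  move=> /(_ isT); rewrite mulnBr => eB.
  have := leq_mul (leqnn b) nB; rewrite mulnDr => eN.
  rewrite -!muln2 in UX *; move: eB eN UX XB.
  have := leq_mul (leqnn b) BnB; lia.
apply/negP; rewrite -ltnNge; apply: (@leq_trans (2 ^ j)); last first.
  by rewrite leq_pmulr // card_gt0.
by apply: leq_ltn_trans Gj; exact: max_card.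
Qed.

Lemma cluster_grow (G : sgraph) z k (X Y : {set G}) : cluster z k X ->
  X \subset Y -> Y \subset nbh X -> cluster z k.+1 Y.
Proof.
move=> [zX cX] XY /subsetP YX; split; first exact: (subsetP XY).
move=> v vY; have /nbhP[x xX xv] := YX v vY; have [P [PX cP zP xP cardP]] := cX
  x xX.
exists (P :|: [set v]); split.
- by rewrite subUset (subset_trans PX) //= sub1set.
- by apply: (connU cP (conn1 v) xP (set11 v)).
- by rewrite inE zP.
- by rewrite !inE eqxx orbT.
- by rewrite setUC (leq_trans (leq_card_setU _ _)) // cards1.
Qed.

Lemma clusterW (G : sgraph) z k l (X : {set G}) :
  k <= l -> cluster z k X -> cluster z l X.
Proof.
move=> kl [zX cX]; split=> // v /cX[P [PX cP zP vP cardP]]; exists P; split=>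
  //.
exact: leq_trans cardP _.
Qed.

Lemma subset_card_between (T : finType) (A B : {set T}) n : A \subset B ->
  #|A| <= n <= #|B| ->
  exists Y : {set T}, [/\ A \subset Y, Y \subset B & #|Y| = n].
Proof.
move=> AB /andP[]; elim: n => [|n IH].
  by rewrite leqn0 => A0 _; exists A; split=> //; apply/eqP.
rewrite leq_eqVlt => /orP[/eqP <- _|/IH{}IH nB]; first by exists A.
have [Y [AY YB Yn]] := IH (ltnW nB).
have /subsetPn[y yB yY] : ~~ (B \subset Y).
  by apply: contraL nB => /subset_leq_card; rewrite Yn -ltnNge ltnS.
exists (y |: Y); split.
- exact: subset_trans AY (subsetUr _ _).
- by rewrite subUset sub1set yB.
- by rewrite cardsU1 yY Yn.
Qed.

(** Any set between two consecutive balls is a cluster, so the size [M] can be hit exactly. *)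
Lemma cluster_in_ball (G : sgraph) (U : {set G}) z k M : z \notin U -> 0 < M ->
  M <= #|iter k (grow U) [set z]| ->
  exists X : {set G},
    [/\ cluster z k X, #|X| = M & X \subset iter k (grow U) [set z]].
Proof.
move=> zU M0.
have dz : [disjoint [set z] & U] by rewrite disjoints1.
have ball i : cluster z i (iter i (grow U) [set z]).
  elim: i => [|i IH].
    split; first exact: set11; move=> v /set1P->; exists [set z].
    by rewrite cards1 set11; split=> //; exact: conn1.
  apply: cluster_grow IH _ (subsetDl _ _).
  by apply: sub_grow; exact: iter_grow_disjoint.
elim: k => [|k IH] /=.
  rewrite cards1 => M1; exists [set z]; rewrite cards1; split=> //.
  by apply/eqP; rewrite eqn_leq M0 M1.
have sk := @iter_grow_sub _ _ _ k k.+1 dz (leqnSn k).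
have [/IH[X [cX XM Xk]] _|kM Mk] := leqP M #|iter k (grow U) [set z]|.
  by exists X; split=> //; [exact: clusterW (leqnSn k) cX | exact: subset_trans
    Xk sk].
have [|Y [kY Yk YM]] := @subset_card_between _ _ _ M sk; first by rewrite ltnW.
exists Y; split=> //; apply: cluster_grow (ball k) kY _.
by apply: subset_trans Yk (subsetDl _ _).
Qed.

Lemma iter_grow_path (G : sgraph) (U X : {set G}) k v : [disjoint X & U] ->
  v \in iter k (grow U) X -> exists P : {set G},
    [/\ conn P, v \in P, ~~ [disjoint P & X], [disjoint P & U] & #|P| <= k.+1].
Proof.
move=> dXU; elim: k v => [|k IH] v /=.
  move=> vX; exists [set v]; rewrite cards1 set11; split=> //; first exact:
    conn1.
    by apply/meetP; exists v; rewrite ?inE.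
  by rewrite disjoints1 (disjointFr dXU).
rewrite inE => /andP[vU /nbhP[x /IH[P [cP xP mP dP cardP]] xv]].
exists (P :|: [set v]); split.
- exact: connU cP (conn1 v) xP (set11 v) _.
- by rewrite !inE eqxx orbT.
- by have [y yP yX] := meetP _ _ mP; apply/meetP; exists y; rewrite // inE yP.
- by rewrite -setI_eq0 setIUl setU_eq0 !setI_eq0 dP disjoints1.
- by rewrite setUC (leq_trans (leq_card_setU _ _)) // cards1.
Qed.

(** If every radius failed, [growth_seq] would give the last ball at least [2 ^ j >= M] vertices. *)
Lemma slow_ball (G : sgraph) b j M (U : {set G}) z : 0 < b -> M <= 2 ^ j ->
  z \notin U -> #|iter (b.*2 * j) (grow U) [set z]| < M ->
  exists B : {set G}, [/\ z \in B, [disjoint B & U], #|B| < M &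
    b.*2 * #|grow U B| <= b.*2.+1 * #|B|].
Proof.
move=> b0 Mj zU small; pose B k := iter k (grow U) [set z].
have dz : [disjoint [set z] & U] by rewrite disjoints1.
have [/existsP[k sk]|/existsPn fast] := boolP
    [exists k : 'I_(b.*2 * j), b.*2 * #|B k.+1| <= b.*2.+1 * #|B k|].
  exists (B k); split=> //; first exact: (subsetP (iter_grow_sub dz (leq0n k)))
    (set11 z).
    exact: iter_grow_disjoint.
  apply: leq_ltn_trans small; apply: subset_leq_card.
  by apply: iter_grow_sub => //; exact: ltnW.
suff : 2 ^ j * #|B 0| <= #|B (b.*2 * j)|.
  by rewrite cards1 muln1 => /leq_ltn_trans/(_ small); rewrite ltnNge Mj.
apply: (@growth_seq b j (fun k => #|B k|)) => // k kj.
by rewrite ltnW // ltnNge; exact: (fast (Ordinal kj)).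
Qed.

(* If every ball outside U stopped growing early, a union of such balls, of
   moderate size, would have too small a neighbourhood. *)
Lemma find_cluster (G : sgraph) b Z j M u (U : {set G}) :
  expanding G b Z -> 0 < b -> Z < #|G| -> 0 < M -> M <= 2 ^ j -> #|U| <= u ->
  2 * (b.*2 * u + 1 + M + u) <= Z ->
  exists z X, [/\ cluster z (b.*2 * j) X, #|X| = M & [disjoint X & U]].
Proof.
move=> expG b0 ZG M0 Mj Uu uZ.
have nbhE (T : {set G}) : #|nbh T| <= #|nbh T :\: U| + u.
  rewrite -(cardsID U (nbh T)) addnC leq_add2l (leq_trans _ Uu) //.
  by apply: subset_leq_card; exact: subsetIr.
have slow2 (T : {set G}) :
    b.*2 * #|nbh T :\: U| <= b.*2.+1 * #|T| -> #|nbh T| <= 2 * #|T| + u.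
  move=> slT; apply: leq_trans (nbhE T) _; rewrite leq_add2r.
  rewrite -(leq_pmul2l (_ : 0 < b.*2)) ?double_gt0 //; apply: leq_trans slT _.
  by rewrite mulnA leq_mul2r; apply/orP; right; lia.
have [//|H] := pselect (exists z X,
  [/\ cluster z (b.*2 * j) X, #|X| = M & [disjoint X & U]]).
(* [T] collects disjoint slow balls until it has [2 b u + 1] vertices; each has fewer than [M]
   vertices, which bounds the overshoot. *)
have slow : forall n, n <= b.*2 * u + 1 -> exists T : {set G},
    n <= #|T| <= b.*2 * u + 1 + M /\ b.*2 * #|nbh T :\: U| <= b.*2.+1 * #|T|.
  elim=> [|n IH] nu; first by exists set0; rewrite nbh0 set0D cards0 !muln0.
  have [T [/andP[nT TM] slT]] := IH (ltnW nu).
  have [nT'|Tn] := ltnP n #|T|; first by exists T; rewrite nT'.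
  have [z zT] : exists z, z \notin nbh T :|: U.
    apply/existsP; apply: contraT => /existsPn all.
    have : #|G| <= #|nbh T :|: U|.
      by rewrite -cardsT; apply: subset_leq_card; apply/subsetP => z _;
        move: (all z); rewrite negbK.
    move/leq_trans/(_ (leq_card_setU _ _)); have := slow2 T slT; lia.
  have zU : z \notin U by apply: contra zT; rewrite inE orbC => ->.
  (* The new ball avoids [nbh T] as well as [U], so it is disjoint from [T] and the two slow-growth
     bounds add up. *)
  have [big|small] := leqP M #|iter (b.*2 * j) (grow (nbh T :|: U)) [set z]|.
    have [X [cX XM Xb]] := cluster_in_ball zT M0 big.
    case: H; exists z, X; split=> //; apply: disjointWl Xb _.
    apply: disjointWr (subsetUr (nbh T) U) _.
    by apply: iter_grow_disjoint; rewrite disjoints1.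
  have [B [zB dB BM slB]] := slow_ball b0 Mj zT small.
  have dTB : [disjoint T & B].
    rewrite disjoint_sym; apply: disjointWr dB.
    exact: subset_trans (sub_nbh T) (subsetUl _ _).
  have TB : #|T :|: B| = #|T| + #|B|.
    by apply/eqP; rewrite (leq_card_setU T B).2.
  exists (T :|: B); rewrite TB; split.
    have : 0 < #|B| by rewrite card_gt0; apply/set0Pn; exists z.
    lia.
  have : #|nbh (T :|: B) :\: U| <= #|nbh T :\: U| + #|grow (nbh T :|: U) B|.
    apply: leq_trans (leq_card_setU _ _); apply: subset_leq_card.
    rewrite nbhU; apply/subsetP => v /setDP[vTB vU]; apply/setUP.
    have [vT|vT] := boolP (v \in nbh T); first by left; apply/setDP.
    right; apply/setDP; split; first by case/setUP: vTB => // vT'; rewrite vT'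
      in vT.
    by apply/setUP => -[vT'|vU']; [rewrite vT' in vT | rewrite vU' in vU].
  move=> le; apply: leq_trans (leq_mul (leqnn _) le) _; rewrite !mulnDr.
  exact: leq_add.
(* Expansion contradicts slowness: [|T| <= b (|nbh T| - |T|) <= |T| / 2 + b u], whereas
   [|T| > 2 b u]. *)
have [T [/andP[uT TM] slT]] := slow _ (leqnn _).
have TZ : #|nbh T| <= Z by apply: leq_trans (slow2 T slT) _; lia.
have := expG T TZ; have := subset_leq_card (sub_nbh T).
have := leq_mul (leqnn b.*2) (nbhE T).
rewrite mulnBr mulnDr -!muln2 in slT uT *; move=> h1 h2 h3.
have := leq_mul (leqnn b) h2; lia.
Qed.

(** * Packings of paths between clusters *)

(* Q is the vertex set of a path from X to Y without its endpoint in Y. *)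
Definition linked (G : sgraph) l (X Y Q : {set G}) : Prop :=
  [/\ conn Q, #|Q| <= l, ~~ [disjoint Q & X], [disjoint Q & Y] &
    exists u e, [/\ u \in Q, e \in Y & adj u e]].

Lemma card_bigcup_leq (I T : finType) (F : I -> {set T}) n :
  (forall i, #|F i| <= n) -> #|\bigcup_i F i| <= #|I| * n.
Proof.
move=> Fn; apply: (@leq_trans (\sum_i #|F i|)).
  elim/big_rec2: _ => [|i k A _ IH]; first by rewrite cards0.
  by rewrite (leq_trans (leq_card_setU _ _)) // leq_add2l.
by rewrite -sum_nat_const; apply: leq_sum => i _; exact: Fn.
Qed.

(** The [i]-th branch set contains the centres of [X i] and [Y i]. The pair [(i, i)] connects these
    centres, and the pair [(i, j)] supplies an edge to the [j]-th branch set. Keeping only the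
    connected pieces that are used gives the order bound. *)
Lemma minor_of_biclique (G : sgraph) t r l (X Y : 'I_t -> {set G})
    (Q : 'I_t -> 'I_t -> {set G}) :
  (forall i, exists z, cluster z r (X i)) ->
  (forall i, exists z, cluster z r (Y i)) ->
  (forall i j, i != j -> [disjoint X i & X j]) ->
  (forall i j, i != j -> [disjoint Y i & Y j]) ->
  (forall i j, [disjoint X i & Y j]) ->
  (forall i j, linked l (X i) (Y j) (Q i j)) ->
  (forall i j k m, i != k -> [disjoint Q i j & Q k m]) ->
  (forall i j k, i != k -> [disjoint Q i j & X k]) ->
  (forall i j k, [disjoint Q i j & Y k]) ->
  exists M : complete_minor G t, km_order M <= t * (t * (r.+1 + l) + t * r.+1).
Proof.
move=> /fin_all_exists[z cX] /fin_all_exists[w cY] dX dY dXY lk dQ dQX dQY.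
(* [F (i, j)] consists of a piece from the centre of [X i] through [Q i j], and a piece of [Y j]
   from its centre to a neighbour of [Q i j]. *)
have [F FE] : exists F : 'I_t * 'I_t -> {set G} * {set G},
    forall ij : 'I_t * 'I_t,
    [/\ [/\ conn (F ij).1, z ij.1 \in (F ij).1,
            (F ij).1 \subset X ij.1 :|: Q ij.1 ij.2 & #|(F ij).1| <= r.+1 + l],
        [/\ conn (F ij).2, w ij.2 \in (F ij).2, (F ij).2 \subset Y ij.2 &
            #|(F ij).2| <= r.+1] &
        exists u e, [/\ u \in (F ij).1, e \in (F ij).2 & adj u e]].
  apply: (fin_all_exists (U := fun=> ({set G} * {set G})%type)
    (P := fun (ij : 'I_t * 'I_t) F =>
    [/\ [/\ conn F.1, z ij.1 \in F.1,
            F.1 \subset X ij.1 :|: Q ij.1 ij.2 & #|F.1| <= r.+1 + l],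
        [/\ conn F.2, w ij.2 \in F.2, F.2 \subset Y ij.2 & #|F.2| <= r.+1] &
        exists u e, [/\ u \in F.1, e \in F.2 & adj u e]])) => -[i j] /=.
  have [cQ Ql /meetP[a aQ aX] _ [u [e [uQ eY ue]]]] := lk i j.
  have [A [AX cA zA aA Ar]] := (cX i).2 a aX.
  have [B [BY cB wB eB Br]] := (cY j).2 e eY.
  exists (A :|: Q i j, B); split=> //=; last by exists u, e; rewrite inE uQ
    orbT.
  split; first by apply: connU cA cQ aA aQ _; rewrite eqxx.
  - by rewrite inE zA.
  - exact: setSU.
  - by rewrite (leq_trans (leq_card_setU _ _)) // leq_add.
pose A i j := (F (i, j)).1; pose B i j := (F (i, j)).2.
(* Mind the indices: [A i j] contains the centre of [X i] and [B j i] that of [Y i], so every piece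
   meets the core [A i i :|: B i i]. *)
pose Br i := \bigcup_j (A i j :|: B j i).
pose W i := X i :|: Y i :|: \bigcup_j Q i j.
have sA i j : A i j \subset Br i.
  by apply/(bigcup_max j) => //; exact: subsetUl.
have sB i j : B j i \subset Br i.
  by apply/(bigcup_max j) => //; exact: subsetUr.
have BrW i : Br i \subset W i.
  apply/bigcupsP => j _; rewrite subUset; apply/andP; split.
    have [[_ _ /subset_trans-> //]] := FE (i, j).
    rewrite /W /= subUset -setUA subsetUl /= setUA.
    by apply: subset_trans (subsetUr _ _); exact: bigcup_sup.
  have [_ [_ _ /subset_trans-> //]] := FE (j, i).
  by rewrite /W /= setUAC subsetUr.
have dW i k : i != k -> [disjoint W i & W k].
  move=> ik; have ki : k != i by rewrite eq_sym.
  apply/negPn/negP => /meetP[v]; rewrite !inE.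
  have dis (S T : {set G}) : [disjoint S & T] -> v \in S -> v \in T -> False.
    by move=> d vS; rewrite (disjointFr d vS).
  case/orP=> [/orP[]|/bigcupP[j _]] vi; case/orP=> [/orP[]|/bigcupP[m _]] vk.
  - exact: dis (dX _ _ ik) vi vk.
  - exact: dis (dXY i k) vi vk.
  - exact: dis (dQX k m i ki) vk vi.
  - exact: dis (dXY k i) vk vi.
  - exact: dis (dY _ _ ik) vi vk.
  - exact: dis (dQY k m i) vk vi.
  - exact: dis (dQX i j k ik) vi vk.
  - exact: dis (dQY i j k) vi vk.
  - exact: dis (dQ i j k m ik) vi vk.
have [|i k ik|i k ik|M MB] := @minor_of_branches G t Br.
- move=> i; have [[cA zA _ _] [cB wB _ _] [u [e [uA eB ue]]]] := FE (i, i).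
  apply: (@conn_cover_sub _ (A i i :|: B i i)); first 1 last.
  + by rewrite subUset sA sB.
  + move=> x /bigcupP[j _]; rewrite in_setU => /orP[xA|xB].
      exists (A i j); have [[cAj zAj _ _] _ _] := FE (i, j); split=> //.
      by apply/meetP; exists (z i); rewrite // inE zA.
    exists (B j i); have [_ [cBj wBj _ _] _] := FE (j, i); split=> //.
    by apply/meetP; exists (w i); rewrite // inE wB orbT.
  + by apply: connU cA cB uA eB _; rewrite ue orbT.
- by apply: disjointW (BrW i) (BrW k) _; exact: dW.
- have [_ _ [u [e [uA eB ue]]]] := FE (i, k); exists u, e.
  by split=> //; [exact: (subsetP (sA i k)) | exact: (subsetP (sB k i))].
exists M; apply: leq_trans MB _; rewrite -[X in X * _]card_ord.
apply: card_bigcup_leq => i; rewrite -mulnDr -[X in X * _]card_ord.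
apply: card_bigcup_leq => j; rewrite (leq_trans (leq_card_setU _ _)) //.
by have [[_ _ _ Al] _ _] := FE (i, j); have [_ [_ _ _ Bl] _] := FE (j, i);
  rewrite leq_add.
Qed.

(** Clusters are chosen one at a time by [find_cluster], forbidding the at most [N * M] vertices
    already covered. *)
Lemma many_clusters (G : sgraph) b Z j M N :
  expanding G b Z -> 0 < b -> Z < #|G| -> 0 < M -> M <= 2 ^ j ->
  2 * (b.*2 * (N * M) + 1 + M + N * M) <= Z ->
  exists C : {set {set G}}, [/\ #|C| = N,
    {in C, forall X : {set G}, #|X| = M /\ exists z, cluster z (b.*2 * j) X} &
    {in C &, forall X Y : {set G}, X != Y -> [disjoint X & Y]}].
Proof.
move=> expG b0 ZG M0 Mj NZ.
suff: forall n, n <= N -> exists C : {set {set G}}, [/\ #|C| = n,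
    {in C, forall X : {set G}, #|X| = M /\ exists z, cluster z (b.*2 * j) X} &
    {in C &, forall X Y : {set G}, X != Y -> [disjoint X & Y]}] by apply.
elim=> [|n IH] nN.
  by exists set0; rewrite cards0; split=> // X; rewrite inE.
have [C [Cn cC dC]] := IH (ltnW nN).
have coverC : #|cover C| <= N * M.
  apply: leq_trans (leq_card_cover C).1 _.
  rewrite (@eq_bigr _ _ _ _ _ _ _ (fun=> M)) => [|X /cC[]//].
  by rewrite sum_nat_const Cn leq_mul2r ltnW // orbT.
have [z [X [cX XM dX]]] := find_cluster expG b0 ZG M0 Mj coverC NZ.
have dXC Y : Y \in C -> [disjoint X & Y].
  by move=> YC; apply: disjointWr dX; exact: (bigcup_max Y).
have XC : X \notin C.
  apply/negP => /dXC; rewrite -setI_eq0 setIid => /eqP X0.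
  by move: XM M0; rewrite X0 cards0 => <-.
exists (X |: C); split.
- by rewrite cardsU1 XC Cn.
- by move=> Y; rewrite in_setU1 => /orP[/eqP->|/cC//]; split=> //; exists z.
move=> Y Y'; rewrite !in_setU1 => /orP[/eqP->|YC] /orP[/eqP->|Y'C].
- by rewrite eqxx.
- by move=> _; exact: dXC.
- by move=> _; rewrite disjoint_sym; exact: dXC.
- exact: dC.
Qed.

Lemma ex_max_card (T : finType) (P : {set T} -> Prop) : P set0 ->
  exists2 A, P A & forall B, P B -> #|B| <= #|A|.
Proof.
move=> P0; have p0 : `[< P set0 >] by apply/asboolP.
case: (@arg_maxnP _ _ (fun A : {set T} => `[< P A >]) (fun A => #|A|) p0).
by move=> A /asboolP PA maxA; exists A => // B /asboolP; exact: maxA.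
Qed.

(** A member [(X, Y, Q)] is a path for the ordered pair [(X, Y)]. The paths are disjoint from each
    other but may run through other clusters, which is what the conflicts account for. *)
Definition packing (G : sgraph) l (C : {set {set G}})
    (PP : {set {set G} * {set G} * {set G}}) : Prop :=
  {in PP, forall p : {set G} * {set G} * {set G},
    [/\ p.1.1 \in C, p.1.2 \in C, p.1.1 != p.1.2 & linked l p.1.1 p.1.2 p.2]} /\
  {in PP &, forall p q : {set G} * {set G} * {set G},
    p != q -> p.1 != q.1 /\ [disjoint p.2 & q.2]}.

Lemma packing_cover (G : sgraph) l (C : {set {set G}}) PP : packing l C PP ->
  #|\bigcup_(p in PP) p.2| <= #|C| ^ 2 * l.
Proof.
move=> [PPl PPd].
apply: (@leq_trans (#|PP| * l)).
  rewrite -sum_nat_const; apply: (@leq_trans (\sum_(p in PP) #|p.2|)).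
    elim/big_rec2: _ => [|i k A _ IH]; first by rewrite cards0.
    by rewrite (leq_trans (leq_card_setU _ _)) // leq_add2l.
  by apply: leq_sum => p /PPl[_ _ _ []].
rewrite leq_mul2r; apply/orP; right.
have inj : {in PP &, injective fst}.
  move=> p q pPP qPP pq; apply/eqP/negPn/negP => /(PPd _ _ pPP qPP)[].
  by rewrite pq eqxx.
rewrite -(card_in_imset inj) -mulnn -cardsX; apply: subset_leq_card.
by apply/subsetP => _ /imsetP[p /PPl[p1 p2 _ _] ->]; rewrite inE p1.
Qed.

(* The balls grown from the clusters of S outside the packed paths are large,
   so two of them meet, and the resulting path is a new member of the packing
   unless its ends were already joined. *)
Lemma max_packing_hole (G : sgraph) b Z j M Q (C : {set {set G}}) PP
    (l := 2 * (b.*2 * j).+1) (u := #|C| ^ 2 * l) :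
  expanding G b Z -> 0 < b -> #|G| < 2 ^ j -> #|G| < Q.+1 * (Z - u) ->
  3 * b * u <= M ->
  {in C, forall X : {set G}, #|X| = M} ->
  {in C &, forall X Y : {set G}, X != Y -> [disjoint X & Y]} ->
  packing l C PP -> (forall PP', packing l C PP' -> #|PP'| <= #|PP|) ->
  forall S : {set {set G}}, S \subset C -> Q < #|S| ->
  exists X Y, [/\ X \in S, Y \in S, X != Y & [exists D, (X, Y, D) \in PP]].
Proof.
move=> expG b0 Gj GQ uM CM dC packP maxP S SC QS.
have [PPl PPd] := packP.
pose U := \bigcup_(p in PP) p.2.
have Uu : #|U| <= u by exact: packing_cover.
have u0 : 0 < u.
  rewrite /u muln_gt0 expn_gt0 /= orbF.
  by rewrite (leq_trans _ (subset_leq_card SC)) // (leq_trans _ QS).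
pose B (X : {set G}) := iter (b.*2 * j) (grow U) (X :\: U).
have dU (X : {set G}) : [disjoint X :\: U & U].
  by rewrite -setI_eq0 setIDAC setDIl setDv setI0.
have BZ X : X \in C -> Z - u <= #|B X|.
  move=> XC; rewrite leq_subLR addnC; apply: leq_trans (leq_add (leqnn _) Uu).
  (* [3 b u <= M] leaves at least [2 b u] vertices of [X] outside [U], as [grow_large] requires. *)
  have XU : M <= #|X :\: U| + u.
    rewrite -(CM X XC) -(cardsID U X) addnC leq_add2l (leq_trans _ Uu) //.
    by apply: subset_leq_card; exact: subsetIr.
  have bu : u <= b * u by rewrite leq_pmull.
  have bUu := leq_mul (leqnn b) Uu.
  apply: grow_large => //; last by rewrite -muln2 mulnAC; lia.
  by rewrite -card_gt0; lia.
have [X [Y [XS YS XY /meetP[v vX vY]]]] : exists X Y,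
    [/\ X \in S, Y \in S, X != Y & ~~ [disjoint B X & B Y]].
  have [/exists_inP[X XS /exists_inP[Y YS /andP[XY dXY]]]|/exists_inPn none] :=
    boolP [exists X in S, exists Y in S, (X != Y) && ~~ [disjoint B X & B Y]].
    by exists X, Y.
  have : #|S| * (Z - u) <= #|[set: G]|.
    apply: (@disjoint_family_card _ _ _ B) => [X Y XS YS XY|X XS].
      by have /exists_inPn/(_ _ YS) := none X XS; rewrite XY /= negbK.
    by rewrite setIT BZ // (subsetP SC).
  rewrite cardsT leqNgt => /negP[]; apply: leq_trans GQ _.
  by rewrite leq_mul2r QS orbT.
have [XC YC] := (subsetP SC _ XS, subsetP SC _ YS).
exists X, Y; split=> //; apply/existsP.
have [P1 [cP1 vP1 mP1 dP1 P1r]] := iter_grow_path (dU X) vX.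
have [P2 [cP2 vP2 mP2 dP2 P2r]] := iter_grow_path (dU Y) vY.
pose P := P1 :|: P2.
have cP : conn P by apply: connU cP1 cP2 vP1 vP2 _; rewrite eqxx.
have dPU : [disjoint P & U] by rewrite -setI_eq0 setIUl setU_eq0 !setI_eq0 dP1.
have mPX : ~~ [disjoint P & X].
  have [x xP] := meetP _ _ mP1; rewrite inE => /andP[_ xX].
  by apply/meetP; exists x; rewrite // inE xP.
have mPY : ~~ [disjoint P & Y].
  have [x xP] := meetP _ _ mP2; rewrite inE => /andP[_ xY].
  by apply/meetP; exists x; rewrite // inE xP orbT.
have [D [cD DP mDX dDY eD]] := conn_link cP mPX mPY (dC _ _ XC YC XY).
have dDU : [disjoint D & U] by exact: disjointWl DP dPU.
have [//|none] := pselect (exists D, (X, Y, D) \in PP).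
have lD : linked l X Y D.
  split=> //; apply: leq_trans (subset_leq_card DP) _.
  by rewrite (leq_trans (leq_card_setU _ _)) // /l mul2n -addnn leq_add.
have notin : (X, Y, D) \notin PP by apply/negP => XYD; apply: none; exists D.
have new p : p \in PP -> (X, Y) != p.1 /\ [disjoint D & p.2].
  move=> pPP; split; last by apply: disjointWr dDU; exact: (bigcup_max p).
  by apply/eqP => XYp; apply: none; exists p.2; rewrite XYp -surjective_pairing.
have /maxP : packing l C ((X, Y, D) |: PP).
  split=> [p|p q]; rewrite !in_setU1; first by case/orP=> [/eqP->|/PPl].
  case/orP=> [/eqP->|pPP]; case/orP=> [/eqP->|qPP].
  - by rewrite eqxx.
  - by move=> _; exact: new.
  - by move=> _; have [ne dis] := new p pPP; rewrite eq_sym disjoint_sym.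
  - exact: PPd.
by rewrite cardsU1 notin ltnn.
Qed.

(** [l] bounds a path made of two ball paths of [2 b j + 1] vertices each, [h] and [N] are dictated
    by [conflict_free_biclique], [u] bounds the vertices on a packing, and [M] is large enough for
    clusters to survive the removal of a packing. *)
Lemma minor_of_expanding (G : sgraph) t b j Z Q (l := 2 * (b.*2 * j).+1)
    (h := 26 * Q * l) (N := h * (t ^ 2 * l * h ^ t)) (u := N ^ 2 * l)
    (M := 3 * b * u) :
  expanding G b Z -> 0 < t -> 0 < b -> 0 < Q ->
  Z < #|G| -> #|G| < 2 ^ j -> #|G| < Q.+1 * (Z - u) ->
  2 * (b.*2 * (N * M) + 1 + M + N * M) <= Z ->
  exists K : complete_minor G t, km_order K <= 2 * t ^ 2 * l.
Proof.
move=> expG t0 b0 Q0 ZG Gj GQ NZ.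
have l0 : 0 < l by [].
have h0 : 0 < h by rewrite !muln_gt0 Q0.
have N0 : 0 < N by rewrite !(muln_gt0, expn_gt0) Q0 t0.
have M0 : 0 < M by rewrite !(muln_gt0, expn_gt0) b0 Q0 t0.
have Mj : M <= 2 ^ j by lia.
have [C [CN cC dC]] := many_clusters expG b0 ZG M0 Mj NZ.
have [|PP packP maxP] := @ex_max_card _ (packing l C).
  by split=> [p|p q]; rewrite inE.
have hole := @max_packing_hole G b Z j M Q C PP expG b0 Gj.
rewrite CN in hole; have {}hole := hole GQ (leqnn _) (fun X XC => (cC X XC).1)
  dC packP maxP.
pose A (X Y : {set G}) := [exists D, (X, Y, D) \in PP].
pose q (X Y : {set G}) := odflt set0 [pick D | (X, Y, D) \in PP].
have qP X Y : A X Y -> (X, Y, q X Y) \in PP.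
  by rewrite /A /q; case: pickP => //= none /existsP[D]; rewrite none.
(* A conflict is a cluster other than [X] that is met by the path; since clusters are disjoint, a
   path causes at most [l] of them. Pairs without a path have [q X Y = set0] and no conflicts. *)
pose conf (X Y : {set G}) := [set W in C | (W != X) && ~~ [disjoint W & q X Y]].
have ql X Y : #|q X Y| <= l.
  rewrite /q; case: pickP => [D /packP.1[_ _ _ []]//|_] /=.
  by rewrite cards0.
have confl X Y : #|conf X Y| <= l.
  apply: leq_trans (ql X Y); rewrite -[leqLHS]muln1.
  apply: (@disjoint_family_card _ _ _ id) => [V W|V].
    by rewrite !inE => /andP[VC _] /andP[WC _]; exact: dC.
  by rewrite inE => /and3P[_ _]; rewrite -setI_eq0 card_gt0.
have [sx [sy [sxt syt usx usy [sxC syC sA confx confy]]]] :=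
  conflict_free_biclique Q0 l0 t0 CN confl hole.
pose X (i : 'I_t) := nth set0 sx i; pose Y (i : 'I_t) := nth set0 sy i.
have Xs i : X i \in sx by rewrite mem_nth ?sxt.
have Ys i : Y i \in sy by rewrite mem_nth ?syt.
have XC i : X i \in C by exact: sxC.
have YC i : Y i \in C by exact: syC.
have Xne i k : i != k -> X i != X k by rewrite /X nth_uniq ?sxt.
have Yne i k : i != k -> Y i != Y k by rewrite /Y nth_uniq ?syt.
have XYq i k : (X i, Y k, q (X i) (Y k)) \in PP by apply/qP/sA.
have XYne i k : X i != Y k by have [] := packP.1 _ (XYq i k).
have outside i k W : W \in C -> W != X i -> W \notin conf (X i) (Y k) ->
    [disjoint q (X i) (Y k) & W].
  by move=> WC WX; rewrite inE WC WX /= negbK disjoint_sym.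
have [|||||||||K Kt] :=
    @minor_of_biclique G t (b.*2 * j) l X Y (fun i k => q (X i) (Y k)).
- by move=> i; have [] := cC _ (XC i).
- by move=> i; have [] := cC _ (YC i).
- by move=> i k /Xne; exact: dC.
- by move=> i k /Yne; exact: dC.
- by move=> i k; exact: dC.
- by move=> i k; have [] := packP.1 _ (XYq i k).
- move=> i k i' k' ii'; have [|//] := packP.2 _ _ (XYq i k) (XYq i' k').
  by apply: contraNneq (Xne _ _ ii') => -[->].
- move=> i k i' ii'; apply: outside => //; first by rewrite eq_sym Xne.
  by apply: confx => //; exact: Xne.
- move=> i k k'; have [<-|kk'] := eqVneq k k'.
    by have [_ _ _ []] := packP.1 _ (XYq i k).
  apply: outside => //; first by rewrite eq_sym.
  by apply: confy => //; exact: Yne.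
by exists K; apply: leq_trans Kt _; rewrite -mulnn /l; lia.
Qed.

(** * Choice of parameters as powers of one integer *)

Lemma leq_mul_expn p x y i k : x <= p ^ i -> y <= p ^ k -> x * y <= p ^ (i + k).
Proof. by move=> xi yk; rewrite expnD leq_mul. Qed.

Lemma leq_expn_expn p x i k : x <= p ^ i -> x ^ k <= p ^ (i * k).
Proof. by move=> xi; case: k => [|k]; rewrite ?muln0 // expnM leq_exp2r. Qed.

Lemma quotient_bound x p y u Q : 2 * u <= y -> Q = 2 * x * p ->
  x * (p * y) <= Q.+1 * (y - u).
Proof.
move=> uy ->; have yu : y <= 2 * (y - u) by lia.
have := leq_mul (leqnn (x * p)) yu; lia.
Qed.

Lemma cluster_volume_bound b p N M : 4 * b + 6 <= p -> 0 < N -> 0 < M ->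
  2 * (b.*2 * (N * M) + 1 + M + N * M) <= p * (N * M).
Proof.
move=> bp N0 M0; have MN : M <= N * M by rewrite leq_pmull.
have := leq_mul bp (leqnn (N * M)); lia.
Qed.

(** All parameters are bounded by powers of [p]: [h] with exponent 2, [N] with [2 t + 3], [u] with
    [4 t + 7], [M] with [4 t + 8]. So the clusters cover at most [p ^ (6 t + 11)] vertices, a factor
    [p] below the expansion scale [p ^ E]. *)
Lemma minor_of_expanding_poly (G : sgraph) t b j p (E := 6 * t + 12)
    (l := 2 * (b.*2 * j).+1) :
  expanding G b (p ^ E) -> 0 < t -> 0 < b -> 0 < j ->
  26 * 2 ^ E.+2 * t ^ 2 * l <= p ->
  p ^ E.+1 <= #|G| -> #|G| < p.+1 ^ E.+1 -> #|G| < 2 ^ j ->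
  exists K : complete_minor G t, km_order K <= 2 * t ^ 2 * l.
Proof.
move=> expG t0 b0 j0 lp pG Gp Gj.
have E2 : 0 < 2 ^ E.+2 by rewrite expn_gt0.
have l0 : 0 < l by [].
have bl : 4 * b + 2 <= l by rewrite /l -muln2; have := leq_pmulr b j0; lia.
have t2 : 0 < t ^ 2 by rewrite expn_gt0 t0.
have lp1 : 26 * 2 ^ E.+2 * l <= p.
  by apply: leq_trans lp; rewrite leq_mul2r leq_pmulr ?orbT.
have lp2 : t ^ 2 * l <= p.
  by apply: leq_trans lp; rewrite -mulnA leq_pmull // muln_gt0 E2.
have lp3 : 26 * l <= p by apply: leq_trans lp1; rewrite -mulnA leq_mul2l
  leq_pmull.
have bp : 4 * b + 6 <= p by lia.
have p1 : 1 < p by lia.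
have p0 : 0 < p by lia.
(* [|G| < (2 p) ^ E.+1 = 2 ^ E.+1 * p * p ^ E]; a further factor 2 covers the loss of
   [u <= p ^ E / 2]. *)
pose Q := 2 ^ E.+2 * p.
pose h := 26 * Q * l; pose N := h * (t ^ 2 * l * h ^ t).
pose u := N ^ 2 * l; pose M := 3 * b * u.
have Q0 : 0 < Q by rewrite muln_gt0 E2.
have hp : h <= p ^ 2.
  by rewrite /h /Q -[p ^ 2]mulnn mulnA mulnAC leq_mul2r lp1 orbT.
have Np : N <= p ^ (2 * t + 3).
  apply: leq_trans (leq_mul_expn hp (leq_mul_expn (i := 1) _ (leq_expn_expn t
    hp))) _.
    by rewrite expn1.
  by rewrite leq_exp2l //; lia.
have up : u <= p ^ (4 * t + 7).
  apply: leq_trans (leq_mul_expn (leq_expn_expn 2 Np) (_ : l <= p ^ 1)) _.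
    by rewrite expn1; lia.
  by rewrite leq_exp2l //; lia.
have Mp : M <= p ^ (4 * t + 8).
  apply: leq_trans (leq_mul_expn (_ : 3 * b <= p ^ 1) up) _.
    by rewrite expn1; lia.
  by rewrite leq_exp2l //; lia.
have NMp : N * M <= p ^ (6 * t + 11).
  apply: leq_trans (leq_mul_expn Np Mp) _.
  by rewrite leq_exp2l //; lia.
have h0 : 0 < h by rewrite !(muln_gt0, expn_gt0) p0.
have N0 : 0 < N by rewrite !(muln_gt0, expn_gt0) p0 t0.
have u0 : 0 < u by rewrite !(muln_gt0, expn_gt0) p0 t0.
have M0 : 0 < M by rewrite !(muln_gt0, expn_gt0) p0 t0 b0.
have ZE : 2 * p ^ (6 * t + 11) <= p ^ E.
  have -> : E = (6 * t + 11).+1 by rewrite /E; lia.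
  by rewrite expnS leq_mul2r p1 orbT.
have uZ : 2 * u <= p ^ E.
  by apply: leq_trans ZE; rewrite leq_mul2l (leq_trans up) // leq_exp2l //; lia.
apply: (@minor_of_expanding G t b j (p ^ E) Q) => //; rewrite -/h -/N -/u -/M
  -/l.
- by apply: leq_trans pG; rewrite ltn_exp2l.
- apply: leq_trans Gp _.
  have pp : p.+1 <= 2 * p by rewrite mul2n -addnn -addn1 leq_add2l.
  apply: (@leq_trans ((2 * p) ^ E.+1)); first by rewrite leq_exp2r.
  by rewrite expnMn [p ^ _]expnS; apply: quotient_bound; rewrite // /Q -expnS.
- apply: (@leq_trans (p * (N * M))); first exact: cluster_volume_bound.
  by apply: leq_trans (leq_mul (leqnn p) NMp) _; rewrite -expnS leq_exp2l //
    -addnS.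
Qed.

(** * Logarithmic expanders *)

Definition edges_in (G : sgraph) (A : {set G}) : {set {set G}} :=
  [set e in edges G | e \subset A].

Lemma edgesP (G : sgraph) (e : {set G}) :
  reflect (exists x y : G, adj x y /\ e = [set x; y]) (e \in edges G).
Proof.
apply: (iffP imset2P) => [[x y _]|[x [y [xy ->]]]].
  by rewrite inE => /andP[_ xy] ->; exists x, y.
by exists x y; rewrite ?inE.
Qed.

(** An edge that meets [S] lies within [nbh S], and any other edge avoids [S]. *)
Lemma edges_split (G : sgraph) (S : {set G}) :
  #|edges G| <= #|edges_in (nbh S)| + #|edges_in (~: S)|.
Proof.
apply: leq_trans (leq_card_setU _ _); apply: subset_leq_card.
apply/subsetP => e eG; have /edgesP[x [y [xy eE]]] := eG.
rewrite in_setU ![e \in edges_in _]inE eG eE !subUset !sub1set ![_ \in ~: S]inE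
  /=.
have nS u v : u \in S -> adj u v -> v \in nbh S.
  by move=> uS uv; apply/nbhP; exists u => //; rewrite uv orbT.
have [xS|xS] := boolP (x \in S).
  by rewrite (subsetP (sub_nbh S)) // (nS x).
have [yS|yS] := boolP (y \in S); last by rewrite orbT.
by rewrite (nS y) 1?adj_sym // (subsetP (sub_nbh S)).
Qed.

Lemma edges_in_induced (G : sgraph) (A : {set G}) (B : {set induced A}) :
  #|edges_in B| <= #|edges_in (val @: B)|.
Proof.
have inj : injective (fun e : {set induced A} => val @: e).
  exact: imset_inj val_inj.
rewrite -(card_imset _ inj); apply: subset_leq_card; apply/subsetP.
move=> _ /imsetP[e + ->]; rewrite inE => /andP[/edgesP[x [y [xy ->]]] eB].
rewrite inE; apply/andP; split; last exact: imsetS.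
by apply/edgesP; exists (val x), (val y); rewrite imsetU !imset_set1.
Qed.

Lemma edges_induced (G : sgraph) (A : {set G}) :
  #|edges_in A| <= #|edges (induced A)|.
Proof.
apply: leq_trans (leq_imset_card (fun e : {set induced A} => val @: e) _).
apply: subset_leq_card; apply/subsetP => e; rewrite inE => /andP[/edgesP].
move=> [x [y [xy ->]]]; rewrite subUset !sub1set => /andP[xA yA].
apply/imsetP; exists [set (Sub x xA : induced A); Sub y yA].
  by apply/edgesP; exists (Sub x xA : induced A), (Sub y yA : induced A).
by rewrite imsetU !imset_set1.
Qed.

Local Open Scope ring_scope.

Definition log_expander (R : realType) (kappa : R) (G : sgraph) : Prop :=
  forall S : {set G}, #|S|%:R * (ln #|G|%:R - ln #|nbh S|%:R) <=
    kappa * (#|nbh S|%:R - #|S|%:R).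

Lemma ler_lnN (R : realType) (m n : nat) : (0 < m)%N -> (m <= n)%N ->
  ln m%:R <= ln n%:R :> R.
Proof. by move=> m0 mn; rewrite ler_ln ?posrE ?ltr0n ?ler_nat //; lia. Qed.

Lemma ln_nat_ge0 (R : realType) (n : nat) : 0 <= ln n%:R :> R.
Proof.
case: n => [|n]; first by rewrite ln0.
by rewrite ln_ge0 // ler1n.
Qed.

(* Pass to a smallest nonempty A spanning at least
   (a + eta ln #|A|) #|A| edges. *)
Lemma log_expander_subgraph (R : realType) (G : sgraph) (a eta : R) :
  0 <= a -> 0 < eta -> (0 < #|G|)%N ->
  (a + eta * ln #|G|%:R) * #|G|%:R <= #|edges G|%:R ->
  exists A : {set G}, [/\ (0 < #|A|)%N,
    (a + eta * ln #|A|%:R) * #|A|%:R <= #|edges (induced A)|%:R &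
    log_expander ((a + eta * ln #|G|%:R) / eta) (induced A)].
Proof.
move=> a0 eta0 G0 GE.
pose g (n : nat) : R := a + eta * ln n%:R.
have g0 n : 0 <= g n.
  by rewrite addr_ge0 // mulr_ge0 ?(ltW eta0) // ln_nat_ge0.
have gS m n : (0 < m)%N -> (m <= n)%N -> g m <= g n.
  by move=> m0 mn; rewrite lerD2l ler_wpM2l ?(ltW eta0) // ler_lnN.
pose P (A : {set G}) := (A != set0) && (g #|A| * #|A|%:R <= #|edges_in A|%:R).
have PT : P setT.
  rewrite /P -card_gt0 cardsT G0 /= (_ : edges_in setT = edges G) //.
  by apply/setP => e; rewrite inE subsetT andbT.
case: (@arg_minnP _ _ P (fun A => #|A|) PT) => A /andP[A0 AE] minA.
have AH : #|induced A| = #|A| by exact: card_induced.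
have small (B : {set induced A}) : B != set0 -> B != setT ->
    #|edges_in B|%:R <= g #|B| * #|B|%:R.
  move=> B0 BT; have Bv : #|val @: B| = #|B| by apply: card_imset; exact:
    val_inj.
  have BA : (#|val @: B| < #|A|)%N.
    rewrite Bv -AH -cardsT; apply: proper_card.
    by rewrite properEneq BT subsetT.
  have : ~~ P (val @: B) by apply: contraL BA => /minA; rewrite -leqNgt.
  rewrite /P imset_eq0 B0 /= -ltNge Bv => /ltW; apply: le_trans.
  by rewrite ler_nat; exact: edges_in_induced.
exists A; split; first by rewrite card_gt0.
  by apply: le_trans AE _; rewrite ler_nat; exact: edges_induced.
move=> S; have eta_ne0 : eta != 0 by rewrite gt_eqF.
have kappa0 : 0 <= g #|G| / eta by rewrite divr_ge0 // ltW.
have SN := subset_leq_card (sub_nbh S).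
have SN' : #|S|%:R <= #|nbh S|%:R :> R by rewrite ler_nat.
have [->|S0] := eqVneq S set0; first by rewrite nbh0 cards0 mul0r subrr mulr0.
have [NT|NT] := eqVneq (nbh S) setT.
  rewrite NT cardsT subrr mulr0 mulr_ge0 // subr_ge0 ler_nat.
  exact: max_card.
have N0 : nbh S != set0.
  by apply: contraNneq S0 => N0; rewrite -subset0 -N0 sub_nbh.
have SC0 : ~: S != set0.
  apply: contraNneq NT => SC0; rewrite eqEsubset subsetT /=.
  by apply: subset_trans (sub_nbh S); rewrite -(setCK S) SC0 setC0.
have SCT : ~: S != setT.
  by apply: contraNneq S0 => SCT; rewrite -(setCK S) SCT setCT.
have cSC : (#|S| + #|~: S| = #|A|)%N by rewrite cardsC AH.
have AE' : g #|A| * #|A|%:R <= #|edges (induced A)|%:R.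
  by apply: le_trans AE _; rewrite ler_nat; exact: edges_induced.
(* By minimality of [A], the nonempty proper subsets [nbh S] and [~: S] miss the required
   density. *)
have split_e : #|edges (induced A)|%:R <=
    g #|nbh S| * #|nbh S|%:R + g #|A| * (#|A|%:R - #|S|%:R).
  apply: (@le_trans _ _ (#|edges_in (nbh S)|%:R + #|edges_in (~: S)|%:R)).
    by rewrite -natrD ler_nat; exact: edges_split.
  apply: lerD; first exact: small.
  apply: le_trans (small _ SC0 SCT) _.
  rewrite -cSC natrD addrAC subrr add0r ler_wpM2r // gS //; first by rewrite
    card_gt0.
  by rewrite leq_addl.
have gN : g #|nbh S| <= g #|G|.
  apply: gS; first by rewrite card_gt0.
  by rewrite (leq_trans (max_card _)) // AH max_card.
(* Cancelling [g #|A| * #|A|] leaves [g #|A| * #|S| <= g #|nbh S| * #|nbh S|], and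
   [g #|A| - g #|nbh S|] is [eta] times the difference of logarithms. *)
have le1 := le_trans AE' split_e.
have le2 : g #|nbh S| * (#|nbh S|%:R - #|S|%:R) <=
    g #|G| * (#|nbh S|%:R - #|S|%:R) by rewrite ler_wpM2r // subr_ge0.
rewrite mulrAC ler_pdivlMr // AH; move: le1; apply: contraTT.
rewrite -!ltNge => lt; rewrite /g in le2 lt *; lra.
Qed.

(** For [|nbh S| <= p ^ E] the difference of logarithms is at least [ln p], which cancels against
    [kappa <= b ln p]. *)
Lemma expanding_of_log_expander (R : realType) (kappa : R) (G : sgraph) b p E :
  log_expander kappa G -> (1 < p)%N -> (p ^ E.+1 <= #|G|)%N ->
  kappa <= b%:R * ln p%:R -> expanding G b (p ^ E).
Proof.
move=> expG p1 pG kb S Np.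
have [->|S0] := eqVneq S set0; first by rewrite cards0.
have SN := subset_leq_card (sub_nbh S).
have N0 : (0 < #|nbh S|)%N by apply: leq_trans SN; rewrite card_gt0.
have lnp : 0 < ln p%:R :> R by rewrite ln_gt0 // ltr1n.
have p0 : (0 < p)%N by exact: ltnW.
have lnX k : ln (p ^ k)%:R = k%:R * ln p%:R :> R.
  by rewrite natrX lnXn ?ltr0n // mulr_natl.
have lnN : ln #|nbh S|%:R <= E%:R * ln p%:R :> R by rewrite -lnX ler_lnN.
have lnG : E.+1%:R * ln p%:R <= ln #|G|%:R :> R.
  by rewrite -lnX ler_lnN // expn_gt0 p0.
rewrite -(ler_nat R) natrM natrB // -(ler_pM2r lnp).
have SN' : 0 <= #|nbh S|%:R - #|S|%:R :> R by rewrite subr_ge0 ler_nat.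
have le1 : #|S|%:R * ln p%:R <= #|S|%:R * (ln #|G|%:R - ln #|nbh S|%:R) :> R.
  by rewrite ler_wpM2l //; rewrite -natr1 in lnG; lra.
have le2 := ler_wpM2r SN' kb.
by have := expG S; lra.
Qed.

Lemma ln2_ge (R : realType) : 1 / 2 <= ln 2 :> R.
Proof.
have := @le_ln1Dx R (- (1 / 2)).
have -> : 1 + - (1 / 2) = 2^-1 :> R by lra.
by rewrite lnV ?posrE //; lra.
Qed.

Lemma nat_root (E m : nat) : (0 < E)%N -> (0 < m)%N ->
  exists2 p, (p ^ E <= m)%N & (m < p.+1 ^ E)%N.
Proof.
move=> E0 m0.
have ex : exists n, (n ^ E <= m)%N by exists 0; rewrite exp0n.
have ub n : (n ^ E <= m)%N -> (n <= m)%N.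
  by apply: leq_trans; case: E E0 {ex} => // E _; case: n => // n; rewrite expnS
    leq_pmulr // expn_gt0.
case: (ex_maxnP ex ub) => p pE maxp; exists p => //.
by rewrite ltnNge; apply/negP => /maxp; rewrite ltnn.
Qed.

(** With [p] the integer root of [|G|] of order [E + 1], take [b] about [kappa / ln p] and [j] about
    [log2 |G| = O(ln p)]: then [b * j], and hence the path length [l], is [O(kappa)]. *)
Lemma minor_of_log_expander (R : realType) t : (0 < t)%N ->
  exists C D : nat, (0 < C)%N /\ forall (kappa : R) (G : sgraph),
    1 <= kappa -> ln #|G|%:R <= kappa -> log_expander kappa G ->
    (C%:R * kappa) ^+ D <= #|G|%:R ->
    exists K : complete_minor G t, (km_order K)%:R <= C%:R * kappa.
Proof.
move=> t0; pose E := (6 * t + 12)%N.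
(* [c0 * l <= p] is demanded by [minor_of_expanding_poly], and [l <= lam * kappa] is shown below.
   The summand 2 in [C] forces [p >= 2], since only [C * kappa < p + 1] is known. *)
pose c0 := (26 * 2 ^ E.+2 * t ^ 2)%N; pose lam := (8 * (4 * E + 6) + 2)%N.
pose C := (c0 * lam + 2)%N.
exists C, E.+1; split=> [|kappa G k1 Gk expG CG]; first by rewrite /C addn2.
have C2 : 2 <= C%:R :> R by rewrite ler_nat /C; lia.
have Ck2 : 2 <= C%:R * kappa by nra.
have G0 : (0 < #|G|)%N.
  rewrite -(ltr_nat R); apply: lt_le_trans CG; apply: exprn_gt0; lra.
have [p pE mp] := nat_root (ltn0Sn E) G0.
have Cp : C%:R * kappa < p%:R + 1.
  have : (C%:R * kappa) ^+ E.+1 < (p.+1)%:R ^+ E.+1 :> R.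
    by apply: le_lt_trans CG _; rewrite -natrX ltr_nat.
  apply: contraTT; rewrite -!leNgt natr1 => le.
  by rewrite lerXn2r ?nnegrE ?ler0n //; lra.
have p2 : (1 < p)%N by rewrite -(ltr_nat R); lra.
have p0 : (0 < p)%N by exact: ltnW.
have lnX q k : (0 < q)%N -> ln (q ^ k)%:R = k%:R * ln q%:R :> R.
  by move=> q0; rewrite natrX lnXn ?ltr0n // mulr_natl.
have ln2 := ln2_ge R.
have lnp : 1 / 2 <= ln p%:R :> R by apply: le_trans ln2 _; exact: ler_lnN.
have lnpk : ln p%:R <= kappa.
  apply: le_trans Gk; apply: ler_lnN => //; apply: leq_trans pE.
  by rewrite expnS leq_pmulr // expn_gt0 p0.
have lnp0 : 0 < ln p%:R :> R by lra.
pose b := (Num.truncn (kappa / ln p%:R)).+1.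
have kl0 : 0 <= kappa / ln p%:R by rewrite divr_ge0 //; lra.
have bk : kappa <= b%:R * ln p%:R.
  by rewrite -ler_pdivrMr // ltW // truncnS_gt.
have b2 : b%:R * ln p%:R <= 2 * kappa.
  rewrite -[X in X * _]natr1 mulrDl mul1r.
  have : (Num.truncn (kappa / ln p%:R))%:R * ln p%:R <= kappa.
    by rewrite -ler_pdivlMr // truncn_le.
  lra.
pose j := (trunc_log 2 #|G|).+1.
have Gj : (#|G| < 2 ^ j)%N by rewrite trunc_log_ltn.
(* [2 ^ (j - 1) <= p ^ (2 (E + 1))] and [ln 2 >= 1/2] give [j - 1 <= (4 E + 4) ln p], and
   [1 <= 2 ln p]. *)
have jp : j%:R <= (4 * E + 6)%:R * ln p%:R :> R.
  have : (2 ^ trunc_log 2 #|G|)%:R <= ((p ^ 2) ^ E.+1)%:R :> R.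
    rewrite ler_nat (leq_trans (trunc_logP _ _)) // (leq_trans (ltnW mp)) //.
    rewrite leq_exp2r // -mulnn (leq_trans _ (leq_mul p2 (leqnn p))) //.
    by rewrite mul2n -addnn -addn1 leq_add2l.
  rewrite -ler_ln ?posrE ?ltr0n ?expn_gt0 ?p0 // !lnX // ?expn_gt0 ?p0 // => le.
  have : (trunc_log 2 #|G|)%:R * (1 / 2) <= (trunc_log 2 #|G|)%:R * ln 2 :> R.
    by rewrite ler_wpM2l.
  have -> : j%:R = (trunc_log 2 #|G|)%:R + 1 :> R by rewrite natr1.
  have -> : (4 * E + 6)%:R = 4 * E%:R + 6 :> R by rewrite natrD natrM.
  have E1 : E.+1%:R = E%:R + 1 :> R by rewrite natr1.
  rewrite E1 in le; lra.
pose l := (2 * (b.*2 * j).+1)%N.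
have lk : l%:R <= lam%:R * kappa.
  have : b%:R * j%:R <= b%:R * ((4 * E + 6)%:R * ln p%:R) :> R.
    by rewrite ler_wpM2l.
  have : (4 * E + 6)%:R * (b%:R * ln p%:R) <= (4 * E + 6)%:R * (2 * kappa) :> R.
    by rewrite ler_wpM2l.
  have -> : l%:R = 4 * (b%:R * j%:R) + 2 :> R.
    by rewrite /l -mul2n natrM -[X in _ * X]natr1 !natrM; lra.
  have -> : lam%:R = 8 * (4 * E + 6)%:R + 2 :> R.
    by rewrite /lam natrD natrM.
  lra.
have [||||||||K Kl] := @minor_of_expanding_poly G t b j p.
- exact: expanding_of_log_expander expG p2 pE bk.
- by [].
- by [].
- by [].
- rewrite -/l -/E -/c0 -ltnS -(ltr_nat R) -natr1 natrM.
  apply: le_lt_trans Cp; rewrite /C natrD natrM mulrDl.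
  have : c0%:R * l%:R <= c0%:R * (lam%:R * kappa) by rewrite ler_wpM2l.
  lra.
- exact: pE.
- exact: mp.
- exact: Gj.
exists K; apply: le_trans (_ : (2 * t ^ 2 * l)%:R <= _).
  by rewrite ler_nat.
rewrite natrM; apply: le_trans (ler_wpM2l (ler0n _ _) lk) _.
rewrite mulrA -natrM ler_wpM2r //; first lra.
rewrite ler_nat /C /c0.
rewrite (leq_trans _ (leq_addr _ _)) // leq_mul // leq_mul //.
by rewrite (leq_trans _ (@leq_pmulr 26 _ _)) // expn_gt0.
Qed.

(** * The theorem *)

Lemma log_expanderW (R : realType) (k1 k2 : R) (G : sgraph) :
  k1 <= k2 -> log_expander k1 G -> log_expander k2 G.
Proof.
move=> k12 expG S; apply: le_trans (expG S) _; rewrite ler_wpM2r // subr_ge0.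
by rewrite ler_nat; apply: subset_leq_card; exact: sub_nbh.
Qed.

(** The weight [eta = eps / ln |G|] turns [a + eta ln |G|] into [a + eps], so the expander has
    parameter [(a + eps) / eps * ln |G| <= k ln |G|]; it is either large enough for
    [minor_of_log_expander] or polylogarithmic. *)
Lemma dense_dichotomy (R : realType) t : (0 < t)%N ->
  exists C D : nat, (0 < C)%N /\ forall (a eps k : R) (G : sgraph),
    0 <= a -> 0 < eps -> (a + eps) / eps <= k -> (0 < #|G|)%N ->
    (a + eps) * #|G|%:R <= #|edges G|%:R ->
    exists A : {set G},
      [/\ (0 < #|A|)%N, a * #|A|%:R <= #|edges (induced A)|%:R &
      (exists K : complete_minor (induced A) t,
        (km_order K)%:R <= C%:R * (k * ln #|G|%:R + 1)) \/
      #|A|%:R <= (C%:R * (k * ln #|G|%:R + 1)) ^+ D].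
Proof.
move=> t0; have [C [D [C0 CD]]] := @minor_of_log_expander R t t0.
exists C, D; split=> // a eps k G a0 eps0 ak G0 GE.
have kge1 : 1 <= k by apply: le_trans ak; rewrite ler_pdivlMr //; lra.
(* A single vertex spans no edge, against the positive density; so [ln #|G|] is positive and may be
   divided by. *)
have [G1|G1] := leqP #|G| 1.
  have eG : #|edges G| = 0%N.
    apply/eqP; rewrite cards_eq0; apply: contraT => /set0Pn[e /edgesP[x [y [xy
      _]]]].
    by move: xy; rewrite (card_le1_eqP G1 x y) ?adj_irrefl // !inE.
  have : (a + eps) * 1 <= (a + eps) * #|G|%:R by rewrite ler_wpM2l ?ler1n //;
    lra.
  by rewrite eG in GE; lra.
have lnG : 0 < ln #|G|%:R :> R by rewrite ln_gt0 // ltr1n.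
have eta0 : 0 < eps / ln #|G|%:R by rewrite divr_gt0.
have [|A [A0 AE expA]] := @log_expander_subgraph R G a _ a0 eta0 G0.
  by rewrite divfK ?gt_eqF.
have AH : #|induced A| = #|A| by exact: card_induced.
have lnA : 0 <= ln #|A|%:R :> R by exact: ln_nat_ge0.
have kG : 0 <= k * ln #|G|%:R by rewrite mulr_ge0 //; lra.
(* The summand 1 makes the parameter at least 1, as [minor_of_log_expander] demands. *)
have expA' : log_expander (k * ln #|G|%:R + 1) (induced A).
  apply: log_expanderW expA; rewrite divfK ?gt_eqF // invf_div mulrA mulrAC.
  by have := ler_wpM2r (ltW lnG) ak; lra.
exists A; split=> //.
  apply: le_trans AE; rewrite ler_wpM2r // lerDl mulr_ge0 // ltW //.
have [small|big] := leP (#|A|%:R : R) ((C%:R * (k * ln #|G|%:R + 1)) ^+ D).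
  by right.
left; apply: CD => //; first lra.
- rewrite AH; apply: (@le_trans _ _ (ln #|G|%:R)); first by rewrite ler_lnN //
  max_card.
  by have := ler_wpM2r (ltW lnG) kge1; lra.
- by rewrite AH ltW.
Qed.

(** [expR y >= (y / (D + 1)) ^ (D + 1)], whose degree exceeds [D]. *)
Lemma expR_dominates (R : realType) (B : R) D : 0 <= B ->
  exists Y : R, forall y, Y <= y -> (B * y) ^+ D <= expR y.
Proof.
move=> B0; exists (B ^+ D * D.+1%:R ^+ D.+1 + 1) => y Yy.
have D0 : 0 < D.+1%:R :> R by rewrite ltr0n.
have y0 : 0 < y.
  by apply: lt_le_trans Yy; rewrite ltr_wpDl // mulr_ge0 // exprn_ge0 // ltW.
have ye : (y / D.+1%:R) ^+ D.+1 <= expR y.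
  have -> : expR y = expR (y / D.+1%:R) ^+ D.+1.
    by rewrite -expRM_natl mulrC divfK ?gt_eqF.
  rewrite lerXn2r // ?nnegrE ?expR_ge0 ?divr_ge0 ?ltW //.
  by apply: lt_le_trans (expR_ge1Dx _); rewrite ltrDr.
apply: le_trans ye; rewrite expr_div_n ler_pdivlMr ?exprn_gt0 //.
rewrite exprMn [y ^+ D.+1]exprS mulrAC ler_wpM2r // ?exprn_ge0 ?(ltW y0) //.
by apply: le_trans Yy; rewrite ler_wpDr.
Qed.

(** The empty graph has density 0, by the convention that 0 has inverse 0, and no nonempty branch
    set. *)
Lemma extremal_density_gt0 (R : realType) t (c : R) : (0 < t)%N ->
  is_extremal_density t c -> 0 < c.
Proof.
move=> t0 [force _]; rewrite ltNge; apply/negP => c0.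
have vsym : symmetric (fun _ _ : void => false) by [].
have virr : irreflexive (fun _ _ : void => false) by [].
have [|M] := force (SGraph vsym virr).
  by rewrite /density card_void invr0 mulr0.
have [/set0Pn[[]] _] := km_connected M (Ordinal t0).
Qed.

Theorem theorem1 (R : realType) :
  exists C : R, 0 < C /\
  forall (eps : R) (t : nat) (c : R), 0 < eps -> (3 <= t)%N ->
  is_extremal_density t c ->
  exists n0 : nat, forall G : sgraph, (n0 <= #|G|)%N ->
    c + eps <= density R G ->
    exists M : complete_minor G t,
      (km_order M)%:R <=
        C * (c * t%:R ^+ 2 / eps * log2 #|G|%:R * log2 (log2 #|G|%:R)).
Proof.
(* The constant 1 suffices: the minor found has order [O(log n)] with a factor depending on [eps],
   [t] and [c], which [log log n] eventually absorbs. *)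
exists 1; split=> // eps t c eps0 t3 ct.
have t0 : (0 < t)%N by exact: leq_trans t3.
have c0 := extremal_density_gt0 t0 ct.
have [C [D [C0 CD]]] := @dense_dichotomy R t t0.
pose alpha := c * t%:R ^+ 2 / eps.
have alpha0 : 0 < alpha by rewrite divr_gt0 // mulr_gt0 // exprn_gt0 // ltr0n.
pose k := 2 * (c + eps) / eps.
have k0 : 0 < k by rewrite divr_gt0 //; lra.
have C1 : 1 <= C%:R :> R by rewrite ler1n.
pose Ck := C%:R * (k + 1).
have Ck1 : 1 <= Ck by rewrite /Ck; nra.
have lnCk : 0 <= ln Ck by rewrite ln_ge0.
(* Two rounds of [dense_dichotomy] leave a set of at most [(B * y) ^ D] vertices, where
   [y = ln (ln #|G|)]. *)
pose B := C%:R * (k * (D%:R * (ln Ck + 1)) + 1).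
have B0 : 0 <= B.
  by rewrite mulr_ge0 ?ler0n // addr_ge0 // mulr_ge0 ?(ltW k0) // mulr_ge0 //
    addr_ge0.
have [Y YB] := @expR_dominates R B D B0.
(* [Y] serves [expR_dominates]; [Ck / alpha] and [alpha^-1] make [alpha * y] at least [Ck] and 1,
   for [bound1] and [bound2]. *)
pose y0 := Num.max 1 (Num.max Y (Num.max (Ck / alpha) alpha^-1)).
exists (Num.truncn (expR (expR y0))).+1 => G nG dG.
pose x : R := ln #|G|%:R.
have Gx : expR (expR y0) <= #|G|%:R.
  by apply: le_trans (ltW (truncnS_gt _)) _; rewrite ler_nat.
have G0 : (0 < #|G|)%N by exact: leq_trans nG.
have G0' : 0 < #|G|%:R :> R by rewrite ltr0n.
have xy : expR y0 <= x by rewrite -ler_expR lnK ?posrE.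
have x0 : 0 < x by apply: lt_le_trans xy; exact: expR_gt0.
pose y := ln x.
have y0y : y0 <= y by rewrite -ler_expR lnK ?posrE.
have [y1 yY yCk ya] : [/\ 1 <= y, Y <= y, Ck / alpha <= y & alpha^-1 <= y].
  by move: y0y; rewrite !ge_max => /andP[-> /andP[-> /andP[-> ->]]].
have xE : expR y = x by rewrite lnK ?posrE.
have x1 : 1 <= x by rewrite -xE; have := expR_ge1Dx y; lra.
have rhs : alpha * x * y <= alpha * log2 #|G|%:R * log2 (log2 #|G|%:R).
  have ln2_gt0 : 0 < ln 2 :> R by have := ln2_ge R; lra.
  have ln2_le1 : ln 2 <= 1 :> R.
    by have := @le_ln1Dx R 1; rewrite -natr1; apply; lra.
  have log2_ge z : 1 <= z -> ln z <= log2 z :> R.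
    move=> z1; rewrite /log2 ler_pdivlMr //.
    by have := ler_wpM2l (ln_ge0 z1) ln2_le1; rewrite mulr1.
  have Gx1 : 1 <= #|G|%:R :> R by rewrite ler1n.
  have xlog : x <= log2 #|G|%:R by exact: log2_ge.
  have ylog : y <= log2 (log2 #|G|%:R).
    apply: le_trans (log2_ge _ (le_trans x1 xlog)).
    by rewrite ler_ln ?posrE // (lt_le_trans x0).
  apply: ler_pM => //; [by rewrite mulr_ge0 // ltW | lra |].
  by rewrite ler_wpM2l // ltW.
have bound1 : C%:R * (k * x + 1) <= alpha * x * y.
  apply: (@le_trans _ _ (Ck * x)).
    rewrite /Ck -mulrA ler_wpM2l ?ler0n //; lra.
  have : Ck <= y * alpha by rewrite -ler_pdivrMr.
  by move/(ler_wpM2r (ltW x0)); lra.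
have bound2 : x <= alpha * x * y.
  have : 1 <= alpha * y by rewrite mulrC -ler_pdivrMr // div1r.
  by move/(ler_wpM2r (ltW x0)); lra.
(* Each of the two rounds spends [eps / 2] of the excess density. *)
have GE : (c + eps / 2 + eps / 2) * #|G|%:R <= #|edges G|%:R.
  by rewrite -ler_pdivlMr //; apply: le_trans dG; lra.
have eps2 : 0 < eps / 2 by lra.
have k1 : (c + eps / 2 + eps / 2) / (eps / 2) <= k.
  have kE : k * eps = 2 * (c + eps) by rewrite divfK ?gt_eqF.
  by rewrite ler_pdivrMr //; lra.
have k2 : (c + eps / 2) / (eps / 2) <= k.
  by apply: le_trans k1; rewrite ler_wpM2r ?invr_ge0 ?(ltW eps2) //; lra.
have c1 : 0 <= c + eps / 2 by lra.
rewrite mul1r -/alpha.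
suff [M MG] : exists M : complete_minor G t, (km_order M)%:R <= alpha * x * y.
  by exists M; apply: le_trans MG rhs.
have [A [A0 AE [[K KG]|AD]]] := CD _ _ _ _ c1 eps2 k1 G0 GE.
  have [M MK] := push_minor K; exists M; rewrite MK.
  exact: le_trans KG bound1.
have AH : #|induced A| = #|A| by exact: card_induced.
have A0' : (0 < #|induced A|)%N by rewrite AH.
rewrite -AH in AE AD.
(* Second round, inside the polylogarithmic [A], whose logarithm is only [O(y)]. *)
have [A' [A'0 A'E cases]] := CD _ _ _ _ (ltW c0) eps2 k2 A0' AE.
suff [K KG] : exists K : complete_minor (induced A') t,
    (km_order K)%:R <= alpha * x * y.
  have [K' K'K] := push_minor K; have [M MK'] := push_minor K'.
  by exists M; rewrite MK' K'K.
have lnA : ln #|induced A|%:R <= x.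
  by apply: ler_lnN => //; rewrite AH max_card.
case: cases => [[K KA]|A'D].
  exists K; apply: le_trans KA (le_trans _ bound1).
  by rewrite ler_wpM2l // lerD2r ler_wpM2l // ltW.
(* The density of [A'] is still at least [c], so a minor exists by the definition of [c]; its order
   is at most [#|A'| <= (B * y) ^ D <= expR y = x]. *)
have [M] : inhabited (complete_minor (induced A') t).
  apply: ct.1; rewrite /density card_induced ler_pdivlMr ?ltr0n //.
exists M; apply: le_trans (_ : #|A'|%:R <= _).
  by rewrite ler_nat -(card_induced A') max_card.
apply: le_trans A'D (le_trans _ bound2); rewrite -xE.
apply: le_trans (YB y yY).
have lnA0 : 0 <= ln #|induced A|%:R :> R by exact: ln_nat_ge0.
have Ckx : 0 < Ck * x by rewrite mulr_gt0 //; lra.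
have lnAD : ln #|induced A|%:R <= D%:R * (ln Ck + y).
  have -> : D%:R * (ln Ck + y) = ln ((Ck * x) ^+ D).
    by rewrite lnXn // lnM ?posrE ?mulr_natl //; lra.
  rewrite ler_ln ?posrE ?ltr0n ?exprn_gt0 //; apply: le_trans AD _.
  apply: lerXn2r; rewrite ?nnegrE ?(ltW Ckx) //.
    by rewrite mulr_ge0 // addr_ge0 // mulr_ge0 // ltW.
  by rewrite /Ck -mulrA ler_wpM2l ?ler0n // -/x; lra.
apply: lerXn2r; rewrite ?nnegrE.
- by rewrite mulr_ge0 // addr_ge0 // mulr_ge0 // ltW.
- by apply: mulr_ge0 B0 (le_trans ler01 y1).
rewrite /B -mulrA ler_wpM2l ?ler0n //.
have D0 : 0 <= D%:R :> R by exact: ler0n.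
have le1 : D%:R * (ln Ck + y) <= D%:R * (ln Ck + 1) * y.
  by rewrite -mulrA ler_wpM2l //; have := ler_wpM2l lnCk y1; lra.
have := ler_wpM2l (ltW k0) (le_trans lnAD le1); lra.
Qed.
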